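(* Let $R\subseteq S$ be an étale, infra-integral Gilmer extension. Then $R\subseteq S$ has FIP if and only if the nucleus $R/(R:S)$ is a FMIR and, for each $M\in\mathrm{Supp}_R(S/R)$ such that $R_M$ is an infinite SPIR, the number of prime ideals of $S$ lying over $M$ is $2$.
   Context: Rings are commutative with identity. $(R:S)=\{r\in R\mid rS\subseteq R\}$; Gilmer extension: $R/(R:S)$ Artinian. Étale: flat, of finite presentation, unramified. Infra-integral: integral with all residual field extensions isomorphisms. FIP: finitely many $R$-subalgebras of $S$. A FMIR is a ring with only finitely many ideals. A SPIR is a local ring $R$ which is not a field, whose maximal ideal $M$ is principal and nilpotent (so $M$ is its unique prime ideal). *)

(* Defs.v *)
From HB Require Import structures.
From mathcomp Require Import all_boot all_order all_algebra.
From mathcomp Require Import mpoly.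
Set Implicit Arguments. Unset Strict Implicit. Unset Printing Implicit Defensive.
Import GRing.Theory.
Local Open Scope ring_scope.

Section Ideals.
Variable A : comNzRingType.

Definition is_ideal (I : A -> Prop) : Prop :=
  [/\ I 0, (forall x y, I x -> I y -> I (x + y)) & (forall a x, I x -> I (a * x))].

Definition is_prime (P : A -> Prop) : Prop :=
  [/\ is_ideal P, ~ P 1 & (forall x y, P (x * y) -> P x \/ P y)].

Definition same_set (I J : A -> Prop) : Prop := forall x, I x <-> J x.

(* The ideals of A / C are in canonical bijection with the ideals of A
   containing the ideal C; we use that description of the ideals of A/C. *)
Definition ideal_above (C I : A -> Prop) : Prop :=
  is_ideal I /\ (forall x, C x -> I x).

Definition quotient_artinian (C : A -> Prop) : Prop :=
  forall I : nat -> A -> Prop,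
    (forall k, ideal_above C (I k)) ->
    (forall k x, I k.+1 x -> I k x) ->
    exists N, forall k, (N <= k)%N -> same_set (I k) (I N).

Definition quotient_FMIR (C : A -> Prop) : Prop :=
  exists (n : nat) (Is : 'I_n -> A -> Prop),
    forall I, ideal_above C I -> exists i, same_set I (Is i).

(* ---------- the localization A_M, written out via fractions a/u, u \notin M ---------- *)
(* a/u = b/v in A_M *)
Definition loc_eq (M : A -> Prop) (a u b v : A) : Prop :=
  exists w, ~ M w /\ w * (a * v - b * u) = 0.

Definition loc_infinite (M : A -> Prop) : Prop :=
  forall (n : nat) (a u : 'I_n -> A), (forall i, ~ M (u i)) ->
    exists b v, ~ M v /\ forall i, ~ loc_eq M b v (a i) (u i).

(* For a prime M, A_M is local with maximal ideal M A_M (= {m/u | m \in M}).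
   A_M is a SPIR: not a field (M A_M <> 0), and M A_M is principal (generated
   by some p/1, p \in M; any generator p/u is associate to p/1) and nilpotent. *)
Definition loc_SPIR (M : A -> Prop) : Prop :=
  (exists m, M m /\ ~ loc_eq M m 1 0 1) /\
  (exists p n, M p /\
     (forall m, M m -> exists a u, ~ M u /\ loc_eq M m 1 (a * p) u) /\
     loc_eq M (p ^+ n) 1 0 1).

End Ideals.

Section Extensions.
Variables (R S : comNzRingType) (f : {rmorphism R -> S}).

Definition preim (Q : S -> Prop) : R -> Prop := fun r => Q (f r).

Definition conductor : R -> Prop :=
  fun r => forall s : S, exists r' : R, f r' = f r * s.

Definition Gilmer_ext : Prop := quotient_artinian conductor.

Definition integral_ext : Prop :=
  forall s : S, exists p : {poly R}, p \is monic /\ root (map_poly f p) s.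

(* residue field extension k(Q ∩ R) -> k(Q) is surjective (hence an isomorphism):
   every x/y in Frac(S/Q) equals the image of some a/b in Frac(R/P). *)
Definition residue_iso (Q : S -> Prop) : Prop :=
  forall x y : S, ~ Q y -> exists a b : R, ~ preim Q b /\ Q (f b * x - f a * y).

Definition infra_integral_ext : Prop :=
  integral_ext /\ forall Q, is_prime Q -> residue_iso Q.

Definition is_subalgebra (T : S -> Prop) : Prop :=
  [/\ forall r, T (f r), (forall x y, T x -> T y -> T (x + y)),
      (forall x, T x -> T (- x)) & (forall x y, T x -> T y -> T (x * y))].

Definition FIP_ext : Prop :=
  exists (n : nat) (Ts : 'I_n -> S -> Prop),
    forall T, is_subalgebra T -> exists i, same_set T (Ts i).

(* flatness, via the equational criterion *)
Definition flat_ext : Prop :=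
  forall (n : nat) (r : 'I_n -> R) (x : 'I_n -> S),
    \sum_(i < n) f (r i) * x i = 0 ->
    exists (m : nat) (a : 'I_n -> 'I_m -> R) (y : 'I_m -> S),
      (forall i, x i = \sum_(j < m) f (a i j) * y j) /\
      (forall j, \sum_(i < n) r i * a i j = 0).

Definition fin_pres_ext : Prop :=
  exists (n : nat) (x : 'I_n -> S),
    let phi := fun p : {mpoly R[n]} => mmap f x p in
    (forall s : S, exists p, phi p = s) /\
    exists (k : nat) (g : 'I_k -> {mpoly R[n]}),
      (forall j, phi (g j) = 0) /\
      (forall p, phi p = 0 -> exists q : 'I_k -> {mpoly R[n]},
                    p = \sum_(j < k) q j * g j).

Definition is_Rderivation (M : lmodType S) (d : S -> M) : Prop :=
  [/\ forall x y, d (x + y) = d x + d y,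
      forall x y, d (x * y) = x *: d y + y *: d x
    & forall (r : R) x, d (f r * x) = f r *: d x].

(* unramified: finite type (implied by finite presentation below) and
   Omega_{S/R} = 0, i.e. every R-derivation of S into any S-module is zero *)
Definition unramified_ext : Prop :=
  forall (M : lmodType S) (d : S -> M), is_Rderivation d -> forall x, d x = 0.

Definition etale_ext : Prop := [/\ flat_ext, fin_pres_ext & unramified_ext].

(* Supp_R(S/R): primes M of R with (S/R)_M <> 0 *)
Definition in_supp (M : R -> Prop) : Prop :=
  is_prime M /\ exists s : S, forall u : R, ~ M u -> ~ exists r, f r = f u * s.

Definition two_primes_over (M : R -> Prop) : Prop :=
  exists Q1 Q2 : S -> Prop,
    [/\ is_prime Q1 /\ same_set (preim Q1) M,
        is_prime Q2 /\ same_set (preim Q2) M,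
        ~ same_set Q1 Q2
      & forall Q, is_prime Q -> same_set (preim Q) M ->
          same_set Q Q1 \/ same_set Q Q2].

End Extensions.

(* Main.v *)
Require Import Defs.
From HB Require Import structures.
From mathcomp Require Import all_boot all_order all_algebra.
From mathcomp Require mpoly.
From mathcomp Require Import finmap boolp classical_sets cardinality ring.

(** Let [C = (R:S)], [A = R/C] and [B = S/C]. Both are Artinian, hence finite
    products of local rings with nilpotent maximal ideals. Unramifiedness and the
    triviality of the residue extensions make [A] surject onto every local factor of
    [B] (Nakayama); flatness makes this surjection injective on the factor of [A]
    below it. Hence [B] is the product of powers [A_i^(n_i)] of the local factors of
    [A], with [n_i >= 2] since the conductor of [A -> B] is zero, and subalgebras can be
    counted:
    - an ideal [L] of [A] is recovered from [A + L B], so FIP implies FMIR;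
    - a local FMIR that is infinite and not a field is a SPIR;
    - subalgebras of [A_i^2] correspond to ideals of [A_i], and those of [k^n] for a
      field [k] are determined by the idempotents they contain;
    - if [A_i] is a SPIR with socle [(q)] and [n_i >= 3], the subalgebras
      [A_i + A_i q (eps_1 + u eps_2)] are distinct for [u] distinct in the residue field.
    Finally [C] vanishes locally at every prime [M] containing it, so [R_M] is a factor of
    [A]: a relation [c s = r] with [c] in [C] is a linear relation between [s] and [1],
    which are independent at two primes of [S] over [M], so that flatness yields a
    determinant outside [M] killing [c]. *)

Set Implicit Arguments. Unset Strict Implicit. Unset Printing Implicit Defensive.
Import GRing.Theory.
Local Open Scope classical_set_scope.
Local Open Scope ring_scope.
Local Open Scope quotient_scope.

(** * Sets and maps *)

Definition surjective (X Y : Type) (h : X -> Y) : Prop := forall y, exists x, h x = y.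

Section FiniteSets.
Implicit Types X Y Z : Type.

Lemma finite_set_enumP X (D : set X) :
  finite_set D <-> exists n (t : 'I_n -> X), forall x, D x -> exists i, x = t i.
Proof.
split=> [|[n [t Dt]]]; last first.
  apply: (@sub_finite_set _ _ (range t)); first by move=> x /Dt[i ->]; exists i.
  exact/finite_image/finite_finset.
elim/Pchoice: X => X in D *; move=> /finite_seqP[s ->].
by exists (size s), (tnth (in_tuple s)) => x /seq_tnthP[i ->]; exists i.
Qed.

Lemma finite_image_section X Y (D : set X) (h : X -> Y) : finite_set (h @` D) ->
  exists N, [/\ finite_set N, N `<=` D & forall x, D x -> exists2 y, N y & h x = h y].
Proof.
move=> fin_hD; have [[x0 _]|/forallNP D0] := pselect (exists x, D x); last first.
  by exists set0; split=> // x /D0.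
have /choice[r rP] : forall y, exists x, (h @` D) y -> D x /\ h x = y.
  move=> y; have [[x Dx hx]|nDy] := pselect ((h @` D) y); first by exists x.
  by exists x0 => /nDy.
exists (r @` (h @` D)); split; first exact: finite_image.
  by move=> _ [y /rP[Dr _] <-].
move=> x Dx; have [_ hr] := rP (h x) (imageP h Dx).
by exists (r (h x)); [exists (h x) | rewrite hr].
Qed.

Lemma finite_image_factor X Y Z (D : set X) (h : X -> Y) (k : X -> Z) :
  (forall x y, D x -> D y -> h x = h y -> k x = k y) ->
  finite_set (h @` D) -> finite_set (k @` D).
Proof.
move=> hk /finite_image_section[N [finN ND DN]].
apply: sub_finite_set (finite_image k finN) => _ [x Dx <-].
have [y Ny hxy] := DN x Dx; exists y => //.
by apply/esym/hk => //; apply: ND.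
Qed.

Lemma finite_set_inj X Y (D : set X) (h : X -> Y) (K : set Y) :
  (forall x y, D x -> D y -> h x = h y -> x = y) ->
  (forall x, D x -> K (h x)) -> finite_set K -> finite_set D.
Proof.
move=> h_inj DK finK; rewrite -[D]image_id; apply: (finite_image_factor h_inj).
by apply: sub_finite_set finK => _ [x /DK Kx <-].
Qed.

Lemma finite_subsets X (D : set X) : finite_set D -> finite_set [set V | V `<=` D].
Proof.
elim/Pchoice: X => X in D *; move=> finD.
pose to_set (F : {fset X}) : set X := [set` F].
apply: (@sub_finite_set _ _ (to_set @` [set` fpowerset (fset_set D)])).
  move=> V VD; have finV := sub_finite_set VD finD.
  by exists (fset_set V); rewrite /to_set /= ?fset_setK // fpowersetE -fset_set_sub.
exact/finite_image/finite_fset.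
Qed.

Lemma finite_families (I : finType) X (D : I -> set X) :
  (forall i, finite_set (D i)) -> finite_set [set h : I -> X | forall i, D i (h i)].
Proof.
elim/Pchoice: X => X in D *; move=> finD.
have /finite_seqP[s sE] : finite_set (\bigcup_i D i).
  by apply: bigcup_finite => //; exact: finite_finset.
apply: (@sub_finite_set _ _ (range (fun (c : {ffun I -> seq_sub s}) i => val (c i)))).
  move=> h Dh; have sh i : h i \in s.
    suff : [set` s] (h i) by [].
    by rewrite -sE; exists i.
  by exists [ffun i => SeqSub (sh i)] => //; apply/funext => i; rewrite ffunE.
exact/finite_image/finite_finset.
Qed.

Definition is_pair X (D : set X) : Prop := exists x y, x <> y /\ D = [set x; y].

Lemma is_pair_image X Y (h : X -> Y) (D : set X) :
  injective h -> is_pair (h @` D) <-> is_pair D.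
Proof.
move=> h_inj; split=> [[x' [y' [xy' hD]]]|[x [y [xy ->]]]]; last first.
  by exists (h x), (h y); split; [move/h_inj | rewrite image_setU !image_set1].
have [x _ hx] : (h @` D) x' by rewrite hD; left.
have [y _ hy] : (h @` D) y' by rewrite hD; right.
exists x, y; split=> [xy|]; first by apply: xy'; rewrite -hx -hy xy.
apply/predeqP => z; rewrite -(image_inj h_inj) hD -hx -hy.
by split=> [[/h_inj|/h_inj]|[|]] ->; [left | right | left | right].
Qed.

Lemma is_pair_finset (J : finType) (E : {set J}) : is_pair [set` E] <-> #|E| = 2%N.
Proof.
split=> [[x [y [/eqP xy ExyP]]]|/eqP/cards2P[x [y [/eqP xy ->]]]].
  apply/eqP/cards2P; exists x, y; split=> //; apply/setP => z; rewrite !inE.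
  have zE : z \in E <-> [set x; y] z by rewrite -ExyP.
  apply/idP/orP => [/zE[]->|zxy]; [by left | by right |].
  by apply/zE; case: zxy => /eqP->; [left | right].
exists x, y; split=> //; apply/seteqP; split=> z /=; rewrite !inE.
  by case/orP => /eqP->; [left | right].
by case=> ->; rewrite eqxx ?orbT.
Qed.

End FiniteSets.

(** * Ideals and quotient rings *)

Section Ideals.
Variable A : comNzRingType.
Implicit Types (I J L P : set A) (a b x y z : A).

Lemma same_setE I J : same_set I J <-> I = J.
Proof. by rewrite predeqP. Qed.

Lemma ideal0 I : is_ideal I -> I 0.
Proof. by case. Qed.

Lemma idealD I x y : is_ideal I -> I x -> I y -> I (x + y).
Proof. by case=> _ ID _; exact: ID. Qed.

Lemma idealMl I a x : is_ideal I -> I x -> I (a * x).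
Proof. by case=> _ _ IM; exact: IM. Qed.

Lemma idealMr I a x : is_ideal I -> I x -> I (x * a).
Proof. by rewrite mulrC; exact: idealMl. Qed.

Lemma idealN I x : is_ideal I -> I x -> I (- x).
Proof. by rewrite -mulN1r; exact: idealMl. Qed.

Lemma idealB I x y : is_ideal I -> I x -> I y -> I (x - y).
Proof. by move=> iI Ix Iy; apply: idealD => //; exact: idealN. Qed.

Lemma ideal_sum I (K : Type) (s : seq K) (p : pred K) (F : K -> A) :
  is_ideal I -> (forall k, p k -> I (F k)) -> I (\sum_(k <- s | p k) F k).
Proof. by case=> I0 ID _ IF; apply: big_ind. Qed.

Lemma ideal_congr I x y : is_ideal I -> I (x - y) -> I x <-> I y.
Proof.
move=> iI Ixy; split=> [Ix|Iy]; last by rewrite -(subrK y x); exact: idealD.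
by rewrite -(subKr x y); exact: idealB.
Qed.

Lemma idealT : is_ideal [set: A].
Proof. by []. Qed.

Lemma prime_ideal P : is_prime P -> is_ideal P.
Proof. by case. Qed.

Lemma prime1 P : is_prime P -> ~ P 1.
Proof. by case. Qed.

Lemma primeM P x y : is_prime P -> P (x * y) -> P x \/ P y.
Proof. by case=> _ _; apply. Qed.

Lemma prime_notM P x y : is_prime P -> ~ P x -> ~ P y -> ~ P (x * y).
Proof. by move=> pP nPx nPy /(primeM pP)[]. Qed.

Lemma primeX P x n : is_prime P -> P (x ^+ n) -> P x.
Proof.
move=> pP; elim: n => [/(prime1 pP) //|n IHn].
by rewrite exprS => /(primeM pP)[].
Qed.

Lemma neq_set_sep I J : I <> J -> (exists2 x, I x & ~ J x) \/ (exists2 x, J x & ~ I x).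
Proof.
move=> IJ; apply: contrapT => /not_orP[sepIJ sepJI]; apply: IJ; apply/seteqP.
by split=> x Ux; apply: contrapT => nUx; [apply: sepIJ | apply: sepJI]; exists x.
Qed.

Definition pideal x : set A := [set y | exists a, y = a * x].

Lemma pideal_ideal x : is_ideal (pideal x).
Proof.
split; first by exists 0; rewrite mul0r.
- by move=> _ _ [a ->] [b ->]; exists (a + b); rewrite mulrDl.
- by move=> a _ [b ->]; exists (a * b); rewrite mulrA.
Qed.

Lemma pideal_refl x : pideal x x.
Proof. by exists 1; rewrite mul1r. Qed.

Lemma pideal_sub I x : is_ideal I -> I x -> pideal x `<=` I.
Proof. by move=> iI Ix _ [a ->]; exact: idealMl. Qed.

Definition prod_ideal I J : set A :=
  [set x | forall K, is_ideal K -> (forall y z, I y -> J z -> K (y * z)) -> K x].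

Lemma prod_ideal_ideal I J : is_ideal (prod_ideal I J).
Proof.
split=> [K iK _|x y Ix Iy K iK IJK|a x Ix K iK IJK]; first exact: ideal0.
- by apply: idealD => //; [apply: Ix | apply: Iy].
- by apply: idealMl => //; apply: Ix.
Qed.

Lemma prod_idealM I J x y : I x -> J y -> prod_ideal I J (x * y).
Proof. by move=> Ix Jy K _; apply. Qed.

Lemma prod_ideal_min I J K : is_ideal K ->
  (forall y z, I y -> J z -> K (y * z)) -> prod_ideal I J `<=` K.
Proof. by move=> iK IJK x; apply. Qed.

Lemma prod_idealA I J L y z :
  prod_ideal I J y -> L z -> prod_ideal I (prod_ideal J L) (y * z).
Proof.
move=> IJy Lz; have iK := prod_ideal_ideal I (prod_ideal J L).
apply: (prod_ideal_min (K := [set y | prod_ideal I (prod_ideal J L) (y * z)]) _ _ IJy).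
  split=> [|u v /= Ku Kv|a u /= Ku] /=; first by rewrite mul0r; exact: (ideal0 iK).
    by rewrite mulrDl; exact: (idealD iK).
  by rewrite -mulrA; exact: (idealMl _ iK).
by move=> u v Iu Jv /=; rewrite -mulrA; do 2!apply: prod_idealM => //.
Qed.

End Ideals.

Definition kernel (A B : comNzRingType) (h : {rmorphism A -> B}) : set A :=
  [set a | h a = 0].

Section IdealQuotient.
Variables (A : comNzRingType) (I : set A).
Hypotheses (iI : is_ideal I) (proper_I : ~ I 1).

Let mem_I : {pred A} := fun x => `[< I x >].

Fact mem_ideal_closed : idealr_closed mem_I.
Proof.
split; [exact/asboolP/(ideal0 iI) | exact/asboolP | move=> a x y /asboolP Ix /asboolP Iy].
by apply/asboolP/(idealD iI) => //; exact: idealMl.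
Qed.

HB.instance Definition _ := isIdealr.Build A mem_I mem_ideal_closed.

Lemma exists_ideal_quotient : exists (B : comNzRingType) (pi : {rmorphism A -> B}),
  surjective pi /\ kernel pi = I.
Proof.
pose pi : {rmorphism A -> {ideal_quot mem_I}} := \pi_({ideal_quot mem_I}).
exists {ideal_quot mem_I}, pi; split=> [b|]; first by exists (repr b); rewrite /pi /= reprK.
apply/predeqP => a; rewrite /kernel /= -(rmorph0 pi).
have := Quotient.idealrBE mem_I a 0; rewrite subr0 => Ia.
by split=> [/eqP|/asboolP aI]; [rewrite -Ia => /asboolP | apply/eqP; rewrite -Ia].
Qed.

End IdealQuotient.

Section FactorMorphism.
Variables (R A B : comNzRingType) (pi : {rmorphism R -> A}) (h : {rmorphism R -> B}).
Hypothesis pi_surj : surjective pi.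
Hypothesis ker_sub : kernel pi `<=` kernel h.

Let lift_pi a := sval (cid (pi_surj a)).
Let lift_piK a : pi (lift_pi a) = a. Proof. exact: svalP (cid (pi_surj a)). Qed.
Definition factor_map a := h (lift_pi a).

Lemma factor_mapE r : factor_map (pi r) = h r.
Proof.
by apply/eqP; rewrite -subr_eq0 -rmorphB ker_sub // /kernel /= rmorphB lift_piK subrr.
Qed.

Fact factor_map_zmod : zmod_morphism factor_map.
Proof. by move=> a b; rewrite -(lift_piK a) -(lift_piK b) -rmorphB !factor_mapE rmorphB. Qed.

Fact factor_map_monoid : monoid_morphism factor_map.
Proof.
split=> [|a b]; first by rewrite -(rmorph1 pi) factor_mapE rmorph1.
by rewrite -(lift_piK a) -(lift_piK b) -rmorphM !factor_mapE rmorphM.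
Qed.

HB.instance Definition _ := GRing.isZmodMorphism.Build A B factor_map factor_map_zmod.
HB.instance Definition _ := GRing.isMonoidMorphism.Build A B factor_map factor_map_monoid.

Lemma exists_factor_rmorphism : exists g : {rmorphism A -> B}, forall r, g (pi r) = h r.
Proof. by exists factor_map; exact: factor_mapE. Qed.

End FactorMorphism.

Section Contraction.
Variables (R A : comNzRingType) (pi : {rmorphism R -> A}).

Lemma preimage_ideal (I : set A) : is_ideal I -> is_ideal (pi @^-1` I).
Proof.
move=> iI; split; rewrite /preimage /=.
- by rewrite rmorph0; exact: ideal0.
- by move=> x y Ix Iy; rewrite rmorphD; exact: idealD.
- by move=> a x Ix; rewrite rmorphM; exact: idealMl.
Qed.

Lemma preimage_prime (P : set A) : is_prime P -> is_prime (pi @^-1` P).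
Proof.
move=> pP; split; first exact/preimage_ideal/prime_ideal.
  by rewrite /preimage /= rmorph1; exact: prime1.
by move=> x y; rewrite /preimage /= rmorphM; exact: primeM.
Qed.

Hypothesis pi_surj : surjective pi.

Lemma image_preimage_surj (U : set A) : pi @` (pi @^-1` U) = U.
Proof. by apply: image_preimage; apply/seteqP; split=> // a _; have [r <-] := pi_surj a. Qed.

Lemma preimage_image_add (U : set R) : (forall x y, U x -> U y -> U (x + y)) ->
  kernel pi `<=` U -> pi @^-1` (pi @` U) = U.
Proof.
move=> UD Uker; apply/seteqP; split=> [x [y Uy yx]|]; last exact: preimage_image.
rewrite -(subrK y x) addrC; apply: UD => //; apply: Uker.
by rewrite /kernel /= rmorphB yx subrr.
Qed.

Lemma preimage_surj_inj : injective (preimage pi).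
Proof.
by move=> U V UV; rewrite -(image_preimage_surj U) UV image_preimage_surj.
Qed.

Lemma image_ideal (I : set R) : is_ideal I -> is_ideal (pi @` I).
Proof.
move=> iI; split; first by exists 0; [exact: ideal0 | rewrite rmorph0].
- by move=> _ _ [x Ix <-] [y Iy <-]; exists (x + y); [exact: idealD | rewrite rmorphD].
- move=> a _ [x Ix <-]; have [b <-] := pi_surj a.
  by exists (b * x); [exact: idealMl | rewrite rmorphM].
Qed.

Lemma preimage_image_ideal (I : set R) : is_ideal I ->
  kernel pi `<=` I -> pi @^-1` (pi @` I) = I.
Proof. by move=> iI; apply: preimage_image_add => x y; exact: idealD. Qed.

Lemma image_prime (P : set R) : is_prime P -> kernel pi `<=` P -> is_prime (pi @` P).
Proof.
move=> pP Pker; have PE := preimage_image_ideal (prime_ideal pP) Pker.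
have imP x : (pi @` P) (pi x) -> P x by rewrite -[in P x]PE.
split; first exact/image_ideal/prime_ideal.
  by rewrite -(rmorph1 pi) => /imP; exact: prime1.
move=> a b; have [x <-] := pi_surj a; have [y <-] := pi_surj b.
rewrite -rmorphM => /imP/(primeM pP)[Px|Py]; [left|right]; exact: imageP.
Qed.

End Contraction.

Definition primes_over (R S : comNzRingType) (f : {rmorphism R -> S}) (M : set R) :
    set (set S) :=
  [set Q | is_prime Q /\ f @^-1` Q = M].

Lemma two_primes_overP (R S : comNzRingType) (f : {rmorphism R -> S}) (M : set R) :
  two_primes_over f M <-> is_pair (primes_over f M).
Proof.
split=> [[Q1 [Q2 [[pQ1 /same_setE Q1M] [pQ2 /same_setE Q2M] /same_setE Q12 only]]]|].
  exists Q1, Q2; split=> //; apply/seteqP; split=> [Q [pQ /same_setE QM]|Q [->|->]] //.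
  by have [/same_setE->|/same_setE->] := only Q pQ QM; [left | right].
move=> [Q1 [Q2 [Q12 primesE]]].
have [pQ1 Q1M] : primes_over f M Q1 by rewrite primesE; left.
have [pQ2 Q2M] : primes_over f M Q2 by rewrite primesE; right.
exists Q1, Q2; split=> [|||Q pQ /same_setE QM].
- by split=> //; exact/same_setE.
- by split=> //; exact/same_setE.
- by rewrite same_setE.
- have : [set Q1; Q2] Q by rewrite -primesE.
  by case=> ->; [left | right].
Qed.

(** * Artinian rings *)

Section NilAt.
Variable A : comNzRingType.
Implicit Types (a b e x y : A).

Definition nil_at e : set A := [set a | exists k, a ^+ k * e = 0].

Lemma nil_at_ideal e : is_ideal (nil_at e).
Proof.
have expr_eq0 x k n : x ^+ k * e = 0 -> (k <= n)%N -> x ^+ n * e = 0.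
  by move=> xk kn; rewrite -(subnK kn) exprD -mulrA xk mulr0.
split; first by exists 1%N; rewrite expr1 mul0r.
- move=> x y [k xk] [l yl]; exists (k + l)%N.
  rewrite exprDn mulr_suml big1 // => i _; rewrite mulrnAl.
  have [li|il] := leqP l i; first by rewrite -mulrA (expr_eq0 _ l) ?mulr0 ?mul0rn.
  by rewrite mulrAC (expr_eq0 _ k) ?mul0r ?mul0rn // -addnBA ?leq_addr // ltnW.
- by move=> a x [k xk]; exists k; rewrite exprMn -mulrA xk mulr0.
Qed.

Lemma nil_at_eq0 e a : a * e = 0 -> nil_at e a.
Proof. by exists 1%N; rewrite expr1. Qed.

Lemma nil_at_fixed e a x : nil_at e a -> x * e = a * x * e -> x * e = 0.
Proof.
move=> [k ak] xax; have xaX n : x * e = a ^+ n * x * e.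
  elim: n => [|n IHn]; first by rewrite mul1r.
  by rewrite {1}IHn -mulrA xax exprSr !mulrA.
by rewrite (xaX k) mulrAC ak mul0r.
Qed.

Lemma unit_notnil_at e a b : e != 0 -> a * b * e = e -> ~ nil_at e a.
Proof.
move=> e_neq0 ab na; move/eqP: e_neq0; apply.
rewrite -[e]mul1r; apply: (nil_at_fixed (a := a * b)); last by rewrite mulr1 ab mul1r.
exact/(idealMr _ (nil_at_ideal e)).
Qed.

End NilAt.

Definition artinian (A : comNzRingType) : Prop :=
  forall I : nat -> set A, (forall k, is_ideal (I k)) ->
    (forall k, I k.+1 `<=` I k) -> exists N, forall k, (N <= k)%N -> I k = I N.

Section ArtinianRing.
Variable A : comNzRingType.
Hypothesis artA : artinian A.
Implicit Types (I J P : set A) (a b e x y : A).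

Lemma minimal_ideal (F : set A -> Prop) : (exists2 I, is_ideal I & F I) ->
  exists I, [/\ is_ideal I, F I & forall J, is_ideal J -> F J -> J `<=` I -> I `<=` J].
Proof.
move=> [I0 iI0 FI0]; apply: contrapT => /forallNP no_min.
pose T := {I : set A | is_ideal I /\ F I}.
have smaller (I : T) : {J : T | sval J `<=` sval I /\ ~ sval I `<=` sval J}.
  apply: cid; case: I => I [iI FI] /=; apply: contrapT => no_smaller.
  apply: (no_min I); split=> // J iJ FJ JI; apply: contrapT => nIJ.
  by apply: no_smaller; exists (exist _ J (conj iJ FJ)).
pose I n : T := iter n (fun J : T => sval (smaller J)) (exist _ I0 (conj iI0 FI0)).
have [k|k|N stable] := artA (I := fun n => sval (I n)).
- by case: (svalP (I k)).
- by case: (svalP (smaller (I k))).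
have stableN : sval (sval (smaller (I N))) = sval (I N) := stable N.+1 (leqnSn N).
by have [_] := svalP (smaller (I N)); rewrite stableN; apply.
Qed.

Lemma ideal_induction (F : set A -> Prop) :
  (forall I, is_ideal I ->
    (forall J, is_ideal J -> J `<=` I -> ~ I `<=` J -> F J) -> F I) ->
  forall I, is_ideal I -> F I.
Proof.
move=> Find I iI; apply: contrapT => nFI.
have [|J [iJ nFJ Jmin]] := @minimal_ideal (fun I => ~ F I); first by exists I.
apply: nFJ; apply: Find => // K iK KJ nJK; apply: contrapT => nFK.
exact: nJK (Jmin K iK nFK KJ).
Qed.

Lemma power_stable a : exists n b, a ^+ n = a ^+ n.+1 * b.
Proof.
have [k|k x [b ->]|N stable] := artA (I := fun n => pideal (a ^+ n)).
- exact: pideal_ideal.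
- by exists (b * a); rewrite exprS mulrA.
have [b ab] : pideal (a ^+ N.+1) (a ^+ N) by rewrite stable //; exact: pideal_refl.
by exists N, b; rewrite mulrC.
Qed.

Lemma prime_maximal P b : is_prime P -> ~ P b -> exists c, P (1 - b * c).
Proof.
move=> pP nPb; have [n [c bc]] := power_stable b; exists c.
have : P (b ^+ n * (1 - b * c)).
  by rewrite mulrBr mulr1 mulrA -exprSr -bc subrr; exact: ideal0 (prime_ideal pP).
by move=> /(primeM pP)[/(primeX pP)|].
Qed.

Lemma idempotent_multiple a : exists e b n,
  [/\ e * e = e, e = a * b & a ^+ n.+1 * (1 - e) = 0].
Proof.
have [n [b ab]] := power_stable a.
have stableX k : a ^+ n = a ^+ (n + k) * b ^+ k.
  elim: k => [|k IHk]; first by rewrite addn0 mulr1.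
  by rewrite {1}IHk exprD {1}ab addnS !exprS exprD; ring.
have aea : a ^+ n.+1 * (a ^+ n.+1 * b ^+ n.+1) = a ^+ n.+1.
  by rewrite mulrA -exprD addSn exprS -mulrA -stableX -exprS.
exists (a ^+ n.+1 * b ^+ n.+1), (a ^+ n * b ^+ n.+1), n; split.
- by rewrite {1}[_ * b ^+ _]mulrC -mulrA aea mulrC.
- by rewrite exprS mulrA.
- by rewrite mulrBr aea mulr1 subrr.
Qed.

(* Nakayama's lemma for an arbitrary ideal [I]: a minimal ideal [K] with
   [K I e <> 0] is generated by some [x], and then [x] lies in [x (nil_at e)]. *)
Lemma nil_at_nakayama e I : I `<=` prod_ideal (nil_at e) I -> forall y, I y -> y * e = 0.
Proof.
set Q := nil_at e => IQI y0 Iy0; apply: contrapT => y0e.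
have iQ : is_ideal Q := nil_at_ideal e.
pose G (K : set A) := exists x y, [/\ K x, I y & x * y * e <> 0].
have [|K [iK [x [y [Kx Iy xy]]] Kmin]] := @minimal_ideal G.
  by exists setT; [exact: idealT | exists 1, y0; rewrite mul1r].
pose xQ := [set z | exists2 q, Q q & z = x * q].
have ixQ : is_ideal xQ.
  split; first by exists 0; [exact: ideal0 | rewrite mulr0].
  - by move=> _ _ [q Qq ->] [r Qr ->]; exists (q + r); [exact: idealD | rewrite mulrDr].
  - by move=> c _ [q Qq ->]; exists (c * q); [exact: idealMl | rewrite mulrCA].
have GxQ : G xQ.
  apply: contrapT => nG; apply: xy.
  have iann : is_ideal [set z | x * z * e = 0].
    split=> [|u v /= xu xv|c u /= xu]; first by rewrite /= mulr0 mul0r.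
      by rewrite mulrDr mulrDl xu xv addr0.
    by rewrite mulrCA -mulrA xu mulr0.
  apply: (prod_ideal_min iann) (IQI _ Iy) => q z Qq Iz /=.
  apply: contrapT => xqz; apply: nG; exists (x * q), z.
  by split=> //; [exists q | rewrite -[x * q * z]mulrA].
have [_ [q _ ->]|q Qq xq] := Kmin _ ixQ GxQ _ x Kx; first exact: idealMr.
by apply: xy; rewrite mulrAC (nil_at_fixed Qq) ?mul0r // [q * x]mulrC -xq.
Qed.

Definition ideal_power I n : set A := iter n (prod_ideal I) setT.

Lemma ideal_power_ideal I n : is_ideal (ideal_power I n).
Proof. by case: n => [|n]; [exact: idealT | exact: prod_ideal_ideal]. Qed.

Lemma ideal_power_decreasing I n : ideal_power I n.+1 `<=` ideal_power I n.
Proof.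
apply: prod_ideal_min; first exact: ideal_power_ideal.
by move=> y z _ Iz; exact: idealMl (ideal_power_ideal I n) Iz.
Qed.

Lemma nil_at_nilpotent e : exists n, forall x, ideal_power (nil_at e) n x -> x * e = 0.
Proof.
have [k|k|N stable] := artA (I := ideal_power (nil_at e)).
- exact: ideal_power_ideal.
- exact: ideal_power_decreasing.
by exists N; apply: nil_at_nakayama; rewrite -[in X in X `<=` _](stable N.+1).
Qed.

End ArtinianRing.

Lemma quotient_artinian_surj (R A : comNzRingType) (pi : {rmorphism R -> A}) (C : set R) :
  surjective pi -> kernel pi = C -> quotient_artinian C -> artinian A.
Proof.
move=> pi_surj kerC artC I iI Idec.
have [k|k x|N stable] := artC (fun k => pi @^-1` I k).
- split; first exact: preimage_ideal.
  by rewrite -kerC => x; rewrite /kernel /preimage /= => ->; exact: ideal0.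
- exact: Idec.
by exists N => k /stable/same_setE; exact: preimage_surj_inj.
Qed.

(** * Decomposition into local components *)

(* [e] is an idempotent such that the ring [e A] is local with nil maximal ideal *)
Definition local_idem (A : comNzRingType) (e : A) : Prop :=
  [/\ e * e = e, e != 0 & forall a, nil_at e a \/ exists b, a * b * e = e].

Definition local_decomposition (A : comNzRingType) (K : finType) (h : A) (e : K -> A) : Prop :=
  [/\ forall k, local_idem (e k), forall k l, k != l -> e k * e l = 0
    & \sum_k e k = h].

Section LocalIdempotents.
Variable A : comNzRingType.
Implicit Types (P : set A) (a b e h x y : A).

Lemma local_idemM e : local_idem e -> e * e = e.
Proof. by case. Qed.

Lemma notnil_at_unit e a : local_idem e -> ~ nil_at e a -> exists b, a * b * e = e.
Proof. by case=> _ _ /(_ a)[]. Qed.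

Lemma local_idem_notnil e : local_idem e -> ~ nil_at e e.
Proof. by case=> ee e0 _; apply: (unit_notnil_at (b := 1) e0); rewrite mulr1. Qed.

Lemma nil_at_prime e : local_idem e -> is_prime (nil_at e).
Proof.
move=> local_e; have [ee e0 _] := local_e; split; first exact: nil_at_ideal.
  by apply: (unit_notnil_at (b := 1) e0); rewrite mulr1 mul1r.
move=> x y xy; have [|/(notnil_at_unit local_e)[b xb]] := pselect (nil_at e x); first by left.
have [|/(notnil_at_unit local_e)[c yc]] := pselect (nil_at e y); first by right.
case: (unit_notnil_at (b := b * c) e0 _ xy).
have -> : x * y * (b * c) * e = (x * b) * (y * c * e) by ring.
by rewrite yc.
Qed.

Lemma local_decomposition_absorb (K : finType) h (e : K -> A) k :
  local_decomposition h e -> h * e k = e k.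
Proof.
move=> [local_e orth <-]; rewrite mulr_suml (bigD1 k) //= big1 ?addr0 => [|l lk].
  exact: local_idemM.
exact: orth.
Qed.

Lemma local_decompositionD (K1 K2 : finType) h1 h2 (e1 : K1 -> A) (e2 : K2 -> A) :
  h1 * h2 = 0 -> local_decomposition h1 e1 -> local_decomposition h2 e2 ->
  local_decomposition (h1 + h2) (fun k : K1 + K2 =>
    match k with inl k1 => e1 k1 | inr k2 => e2 k2 end).
Proof.
move=> h12 d1 d2; have orth12 k l : e1 k * e2 l = 0.
  rewrite -(local_decomposition_absorb k d1) -(local_decomposition_absorb l d2).
  by rewrite mulrACA h12 mul0r.
case: d1 d2 => local1 orth1 sum1 [local2 orth2 sum2]; split; first by case.
  move=> [k|k] [l|l] // kl; [exact: orth1 | by rewrite mulrC | exact: orth2].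
by rewrite big_sumType /= sum1 sum2.
Qed.

Hypothesis artA : artinian A.

Lemma idem_split h : h * h = h -> h != 0 -> ~ local_idem h ->
  exists e, [/\ e * e = e, e * h = e, e <> 0 & e <> h].
Proof.
move=> hh h0 nloc.
have [a /not_orP[nnil nunit]] :
    exists a, ~ (nil_at h a \/ exists b, a * b * h = h).
  by apply/existsNP => loc; apply: nloc.
have [e [b [n [ee eab en]]]] := idempotent_multiple artA (a * h).
exists e; split=> //; first by rewrite eab -!mulrA [b * h]mulrC !mulrA -[a * h * h]mulrA hh.
- have hX m : h ^+ m.+1 = h by elim: m => // m IHm; rewrite exprS IHm.
  by move=> e0; apply: nnil; exists n.+1; rewrite -[RHS]en e0 subr0 mulr1 exprMn hX.
- by move=> e_h; apply: nunit; exists b; rewrite mulrAC -eab.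
Qed.

Lemma local_decomposition_idem h : h * h = h ->
  exists (K : finType) (e : K -> A), local_decomposition h e.
Proof.
suff decomp I : is_ideal I -> forall f, pideal f = I -> f * f = f ->
    exists (K : finType) (e : K -> A), local_decomposition f e.
  exact: (decomp _ (pideal_ideal h)).
move: I; apply: (ideal_induction artA) => I iI IH {}h hI hh.
have [->|h0] := eqVneq h 0.
  by exists void, (fun=> 0); split=> [[]|[]|]; rewrite big1.
have [loc|nloc] := pselect (local_idem h).
  by exists unit, (fun=> h); split=> [|[] []//|]; rewrite ?big_const ?card_unit /= ?addr0.
have [e [ee eh e0 e_h]] := idem_split hh h0 nloc.
have split_off f : f * f = f -> f * h = f -> f <> h ->
    exists (K : finType) (e : K -> A), local_decomposition f e.
  move=> ff fh nfh; apply: (IH (pideal f)) => //; first exact: pideal_ideal.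
    by rewrite -hI; apply: (pideal_sub (pideal_ideal h)); exists f; rewrite fh.
  rewrite -hI => /(_ _ (pideal_refl h))[c hc]; apply: nfh.
  by rewrite -fh {1}hc mulrCA ff -hc.
have [|||K1 [e1 d1]] := split_off e => //.
have [|||K2 [e2 d2]] := split_off (h - e).
- by rewrite mulrBl !mulrBr hh ee eh mulrC eh subrr subr0.
- by rewrite mulrBl hh eh.
- by move=> he; apply: e0; rewrite -(subKr h e) he subrr.
exists (K1 + K2)%type; eexists; rewrite -(subrKC e h).
by apply: local_decompositionD d1 d2; rewrite mulrBr eh ee subrr.
Qed.

End LocalIdempotents.

Section Decomposed.
Variables (A : comNzRingType) (K : finType) (e : K -> A).
Hypothesis decomp_e : local_decomposition 1 e.
Implicit Types (P : set A) (x y : A).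

Let local_e k : local_idem (e k). Proof. by case: decomp_e. Qed.

Lemma decomp_sum x : x = \sum_k x * e k.
Proof. by case: decomp_e => _ _ e1; rewrite -mulr_sumr e1 mulr1. Qed.

Lemma decomp_idemE k l : e k * e l = if k == l then e k else 0.
Proof.
have [<-|kl] := eqVneq k l; first exact: local_idemM.
by case: decomp_e => _ + _; apply.
Qed.

Lemma decomp_ideal (I : set A) x : is_ideal I -> (forall k, I (x * e k)) -> I x.
Proof. by move=> iI Ixe; rewrite [x]decomp_sum; exact: ideal_sum. Qed.

Lemma decomp_prime P : is_prime P -> exists k, P = nil_at (e k).
Proof.
move=> pP; have iP := prime_ideal pP.
have [k nPk] : exists k, ~ P (e k).
  apply/existsNP => Pe; apply: (prime1 pP); apply: decomp_ideal => // k.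
  by rewrite mul1r.
exists k; apply/seteqP; split=> [x Px|x [n xn]].
  apply: contrapT => /(notnil_at_unit (local_e k))[b xb]; apply: nPk; rewrite -xb.
  by do 2!apply: idealMr => //.
have : P (x ^+ n * e k) by rewrite xn; exact: ideal0.
by move=> /(primeM pP)[/(primeX pP)|].
Qed.

Lemma nil_at_inj : injective (fun k => nil_at (e k)).
Proof.
move=> k l kl; apply: contrapT => /eqP neq_kl; apply: (local_idem_notnil (local_e l)).
by rewrite -kl; apply: nil_at_eq0; rewrite decomp_idemE eq_sym (negbTE neq_kl).
Qed.

End Decomposed.

(** * Local rings with finitely many ideals *)

Lemma quotient_FMIR_finiteP (A : comNzRingType) (C : set A) :
  quotient_FMIR C <-> finite_set (ideal_above C).
Proof.
rewrite finite_set_enumP; split=> -[n [Is IsP]]; exists n, Is => I /IsP[i Ii];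
  by exists i; exact/same_setE.
Qed.

Section FiniteIdeals.
Variables (A : comNzRingType) (e : A).
Hypothesis local_e : local_idem e.
Implicit Types (a b u x y : A).

Definition residue_coset a : set A := [set b | nil_at e (a - b)].

Definition residue_finite : Prop := finite_set (range residue_coset).

Definition field_at : Prop := forall a, nil_at e a -> a * e = 0.

Definition nil_at_principal : Prop :=
  exists2 t, nil_at e t & forall m, nil_at e m -> pideal (t * e) (m * e).

Definition SPIR_at : Prop := ~ field_at /\ nil_at_principal.

Lemma residue_coset_inj a b : residue_coset a = residue_coset b -> nil_at e (a - b).
Proof.
by move/seteqP => [_]; apply; rewrite /residue_coset /= subrr; exact: ideal0 (nil_at_ideal e).
Qed.

Lemma eq_residue_coset a b : nil_at e (a - b) -> residue_coset a = residue_coset b.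
Proof.
have nI := nil_at_ideal e.
have sub x y : nil_at e (x - y) -> residue_coset x `<=` residue_coset y.
  move=> nxy c nxc; rewrite /residue_coset /=; have -> : y - c = (x - c) - (x - y) by ring.
  exact: idealB.
by move=> nab; apply/seteqP; split; apply: sub => //; rewrite -opprB; exact: idealN.
Qed.

Hypothesis fin_ideals : finite_set (@is_ideal A).

Lemma finite_pideals (Y : Type) (D : set Y) (F : Y -> A) :
  finite_set ((fun z => pideal (F z)) @` D).
Proof. by apply: sub_finite_set fin_ideals => _ [y _ <-]; exact: pideal_ideal. Qed.

Lemma residue_finite_component : artinian A -> residue_finite -> finite_set (pideal e).
Proof.
move=> artA /finite_image_section[C [finC _ residueC]].
suff fin I : is_ideal I -> forall x, I = pideal (x * e) -> finite_set I.
  by apply: (fin _ (pideal_ideal e) 1); rewrite mul1r.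
move: I; apply: (ideal_induction artA) => I iI IH x IE.
have [xe0|/eqP xe0] := eqVneq (x * e) 0.
  apply: (@sub_finite_set _ _ [set 0]); last exact: finite_set1.
  by rewrite IE xe0 => _ [a ->]; rewrite mulr0.
pose subideal m := pideal (m * x * e).
pose translate c (J : set A) := (fun t => c * (x * e) + t) @` J.
apply: (@sub_finite_set _ _
  (\bigcup_(c in C) \bigcup_(J in subideal @` nil_at e) translate c J)).
  rewrite IE => _ [a ->]; have [c Cc /residue_coset_inj nac] := residueC a Logic.I.
  exists c => //; exists (subideal (a - c)); first exact: imageP.
  by exists ((a - c) * x * e); [exact: pideal_refl | ring].
apply: bigcup_finite => // c _; apply: bigcup_finite; first exact: finite_pideals.
move=> _ [m nm <-]; apply: finite_image; apply: (IH _ _ _ _ (m * x)) => //.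
- exact: pideal_ideal.
- by rewrite IE; apply: pideal_sub (pideal_ideal _) _; exists m; rewrite mulrA.
- rewrite IE => /(_ _ (pideal_refl _))[b xb]; apply: xe0.
  apply: (nil_at_fixed (a := b * m)); first exact/(idealMl _ (nil_at_ideal e)).
  by rewrite {1}xb; ring.
Qed.

(* Two values [u], [v] in distinct residue classes give the same ideal
   [(x + u y) e A]; it contains [(u - v) y e], hence [y e] and [x e]. *)
Lemma two_generated_principal x y : ~ residue_finite ->
  exists u, pideal ((x + u * y) * e) (x * e) /\ pideal ((x + u * y) * e) (y * e).
Proof.
move=> inf_residue; apply: contrapT => no_gen; apply: inf_residue.
pose ideal_of u := pideal ((x + u * y) * e).
apply: (finite_image_factor (h := ideal_of)); last exact: finite_pideals.
move=> u v _ _ uv; apply: eq_residue_coset.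
apply: contrapT => /(notnil_at_unit local_e)[b ub]; apply: no_gen; exists u.
have iz := pideal_ideal ((x + u * y) * e).
have zu : ideal_of u ((x + u * y) * e) := pideal_refl _.
have zv : ideal_of u ((x + v * y) * e) by rewrite uv; exact: pideal_refl.
have zy : ideal_of u (y * e).
  have -> : y * e = b * ((x + u * y) * e - (x + v * y) * e) by rewrite -{1}ub; ring.
  by apply: idealMl => //; exact: idealB.
split=> //; have -> : x * e = (x + u * y) * e - u * (y * e) by ring.
by apply: idealB => //; exact: idealMl.
Qed.

Lemma finitely_generated_principal (s : seq A) : ~ residue_finite ->
  (forall x, x \in s -> nil_at e x) ->
  exists2 t, nil_at e t & forall x, x \in s -> pideal (t * e) (x * e).
Proof.
move=> inf_residue; have nI := nil_at_ideal e.
elim: s => [_|x s IHs nil_s]; first by exists 0 => //; exact: ideal0.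
have [|t nt st] := IHs; first by move=> y ys; apply: nil_s; rewrite inE ys orbT.
have [u [zt zx]] := two_generated_principal t x inf_residue.
exists (t + u * x).
  by apply: idealD => //; apply: idealMl => //; apply: nil_s; exact: mem_head.
move=> y; rewrite inE => /predU1P[-> //|/st].
exact: pideal_sub (pideal_ideal _) zt _.
Qed.

Lemma infinite_residue_principal : ~ residue_finite -> nil_at_principal.
Proof.
move=> inf_residue.
have [N [/finite_seqP[s NE] Nnil Ngen]] :=
  finite_image_section (finite_pideals (nil_at e) (fun m => m * e)).
have mem_s y : y \in s <-> N y by rewrite NE.
have [|t nt st] := finitely_generated_principal inf_residue (s := s).
  by move=> y /mem_s/Nnil.
exists t => // m /Ngen[y Ny my].
apply: (pideal_sub (pideal_ideal _) (st y _)); first exact/mem_s.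
by rewrite -my; exact: pideal_refl.
Qed.

Lemma infinite_component_SPIR :
  artinian A -> ~ finite_set (pideal e) -> ~ field_at -> SPIR_at.
Proof.
move=> artA inf_e nfield; split=> //; apply: infinite_residue_principal.
by move/(residue_finite_component artA).
Qed.

Lemma SPIR_at_square_zero : SPIR_at -> exists q, [/\ q <> 0, q * e = q & q * q = 0].
Proof.
have [ee /eqP e0 _] := local_e.
move=> [/existsNP[m /not_implyP[nm me]] [t nt /(_ m nm)[a mt]]].
have nil_t : exists k, t ^+ k * e == 0 by have [k /eqP] := nt; exists k.
case: (ex_minnP nil_t) => k /eqP tk kmin.
have k_gt1 : (1 < k)%N.
  case: k tk {kmin} => [|[|//]]; first by rewrite mul1r.
  by rewrite expr1 => te; case: me; rewrite mt te mulr0.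
exists (t ^+ k.-1 * e); split; last 1 first.
- rewrite mulrACA ee -exprD.
  have -> : (k.-1 + k.-1 = k + k.-2)%N.
    by case: k k_gt1 {tk kmin} => [|[|k]] //= _; rewrite addnS addSn.
  by rewrite exprD mulrAC tk mul0r.
- by move=> /eqP/kmin; rewrite leqNgt prednK ?leqnn // ltnW.
- by rewrite -mulrA ee.
Qed.

End FiniteIdeals.

Section LocalizationAtComponent.
Variables (A : comNzRingType) (e : A).
Hypothesis local_e : local_idem e.
Implicit Types (a b u v : A).

Let prime_nil : is_prime (nil_at e). Proof. exact: nil_at_prime. Qed.

Lemma loc_eq_nil_at a u b v :
  loc_eq (nil_at e) a u b v <-> a * v * e = b * u * e.
Proof.
have -> : a * v * e = b * u * e <-> (a * v - b * u) * e = 0.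
  by rewrite mulrBl; split=> [->|/eqP]; rewrite ?subrr // subr_eq0 => /eqP.
split=> [[w [/(notnil_at_unit local_e)[c wc] wz]]|abe].
  by rewrite -wc; have -> : (a * v - b * u) * (w * c * e)
    = w * (a * v - b * u) * (c * e) by [ring]; rewrite wz mul0r.
by exists e; split; [exact: local_idem_notnil | rewrite mulrC].
Qed.

Lemma loc_infinite_nil_at : loc_infinite (nil_at e) <-> ~ finite_set (pideal e).
Proof.
split=> [inf /finite_set_enumP[n [t tP]]|inf n a u u_unit].
  have [|b [v [v_unit bv]]] := inf n t (fun=> 1); first by move=> _; exact: prime1 prime_nil.
  have [c vc] := notnil_at_unit local_e v_unit.
  have [i bci] := tP (b * c * e) (ex_intro _ (b * c) erefl).
  apply: (bv i); apply/loc_eq_nil_at; rewrite -bci mulr1.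
  have -> : b * c * e * v * e = b * (v * c * e) * e by ring.
  by rewrite vc -mulrA local_idemM.
have /choice[c uc] i := notnil_at_unit local_e (u_unit i).
apply: contrapT => all_eq; apply: inf; apply/finite_set_enumP.
exists n, (fun i => a i * c i * e) => _ [b ->].
apply: contrapT => /forallNP bn; apply: all_eq; exists b, 1.
split; first exact: prime1 prime_nil.
move=> i /loc_eq_nil_at bu; apply: (bn i).
have -> : b * e = c i * (b * u i * e) by rewrite -{1}(uc i); ring.
by rewrite bu; ring.
Qed.

Lemma loc_SPIR_nil_at : loc_SPIR (nil_at e) <-> SPIR_at e.
Proof.
have zero_loc m : loc_eq (nil_at e) m 1 0 1 <-> m * e = 0.
  by rewrite loc_eq_nil_at !mulr1 mul0r.
split=> [[[m [nm m0]] [t [n [nt [gen _]]]]]|[nfield [t nt gen]]].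
  split; first by move/(_ m nm)/zero_loc.
  exists t => // {m0}m' /gen[a [u [/(notnil_at_unit local_e)[c uc] /loc_eq_nil_at mu]]].
  exists (c * a); have -> : m' * e = c * (m' * u * e) by rewrite -{1}uc; ring.
  by rewrite mu; ring.
split.
  move/existsNP: nfield => [m /not_implyP[nm m0]].
  by exists m; split=> // /zero_loc.
have [k tk] := nt; exists t, k; split=> //; split; last exact/zero_loc.
move=> m' /gen[a ma]; exists a, 1; split; first exact: prime1 prime_nil.
by apply/loc_eq_nil_at; rewrite !mulr1 ma mulrA.
Qed.

End LocalizationAtComponent.

(** * Unramified and flat extensions *)

Definition residue_surj (R S : comNzRingType) (f : {rmorphism R -> S}) (Q : set S) : Prop :=
  forall s, exists r, Q (s - f r).

Lemma artinian_residue_surj (R S : comNzRingType) (f : {rmorphism R -> S}) (Q : set S) :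
  artinian R -> is_prime Q -> residue_iso f Q -> residue_surj f Q.
Proof.
move=> artR pQ isoQ s; have iQ := prime_ideal pQ.
have [a [b [nQb Qab]]] := isoQ s 1 (prime1 pQ).
have [c Qbc] := prime_maximal artR (preimage_prime f pQ) nQb.
exists (c * a).
have -> : s - f (c * a) = f (1 - b * c) * s + f c * (f b * s - f a * 1).
  by rewrite !(rmorphB, rmorphM, rmorph1); ring.
by apply: idealD => //; [exact: idealMr | exact: idealMl].
Qed.

Definition restr_scalars (S B : comNzRingType) (pi : {rmorphism S -> B})
  (M : lmodType B) : Type := M.

Section RestrictionOfScalars.
Variables (S B : comNzRingType) (pi : {rmorphism S -> B}) (M : lmodType B).

HB.instance Definition _ := GRing.Zmodule.on (restr_scalars pi M).

Let scale (s : S) (x : restr_scalars pi M) : restr_scalars pi M := pi s *: (x : M).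

Fact restr_scalerA a b v : scale a (scale b v) = scale (a * b) v.
Proof. by rewrite /scale rmorphM scalerA. Qed.

Fact restr_scale1r : left_id 1 scale.
Proof. by move=> v; rewrite /scale rmorph1 scale1r. Qed.

Fact restr_scalerDr : right_distributive scale +%R.
Proof. by move=> a u v; rewrite /scale scalerDr. Qed.

Fact restr_scalerDl v : {morph scale^~ v : a b / a + b}.
Proof. by move=> a b; rewrite /scale rmorphD scalerDl. Qed.

HB.instance Definition _ := GRing.Zmodule_isLmodule.Build S (restr_scalars pi M)
  restr_scalerA restr_scale1r restr_scalerDr restr_scalerDl.

Lemma restr_scaleE s (x : restr_scalars pi M) : s *: x = pi s *: (x : M).
Proof. by []. Qed.

End RestrictionOfScalars.

Section Unramified.
Variables (R S : comNzRingType) (f : {rmorphism R -> S}).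
Hypothesis unr : unramified_ext f.

Lemma unramified_rmorphism_unique (B : comNzRingType) (h1 h2 : {rmorphism S -> B}) :
  (forall r, h1 (f r) = h2 (f r)) ->
  (forall x y, (h1 x - h2 x) * (h1 y - h2 y) = 0) -> h1 =1 h2.
Proof.
move=> h12 sq0 x; pose d s : restr_scalars h1 B^o := h1 s - h2 s.
suff /eqP : d x = 0 by rewrite subr_eq0 => /eqP.
apply: (unr (d := d)); split=> [y z|y z|r y]; rewrite ?restr_scaleE /d.
- by rewrite !rmorphD opprD addrACA.
- rewrite !rmorphM; apply/eqP; rewrite -subr_eq0 -[X in _ == X]oppr0 -(sq0 y z).
  by apply/eqP; rewrite /GRing.scale /=; ring.
- by rewrite !rmorphM -h12 -mulrBr.
Qed.

(* As [R -> S / Q] is surjective and [J] contains the image of its kernel,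
   [S -> S / Q] lifts to a morphism [S -> S / J], which agrees with the
   projection modulo the square-zero ideal [Q / J]. *)
Lemma unramified_ideal (Q J : set S) : is_prime Q -> residue_surj f Q -> is_ideal J ->
  (forall x y, Q x -> Q y -> J (x * y)) -> (forall r, Q (f r) -> J (f r)) -> Q `<=` J.
Proof.
move=> pQ surjQ iJ QQJ QRJ x Qx.
have [J1|nJ1] := pselect (J 1); first by rewrite -[x]mulr1; exact: idealMl.
have [B [piJ [_ kerJ]]] := exists_ideal_quotient iJ nJ1.
have [K [piQ [piQ_surj kerQ]]] := exists_ideal_quotient (prime_ideal pQ) (prime1 pQ).
have piQE s r : Q (s - f r) -> piQ s = piQ (f r).
  by rewrite -kerQ /kernel /= rmorphB => /eqP; rewrite subr_eq0 => /eqP.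
have [b|r|lift liftE] := @exists_factor_rmorphism _ _ _ (piQ \o f) (piJ \o f).
- by have [s <-] := piQ_surj b; have [r /piQE ->] := surjQ s; exists r.
- by move=> piQr; suff : kernel piJ (f r) by []; rewrite kerJ; apply: QRJ; rewrite -kerQ.
have proj_lift s : exists2 q, Q q & piJ s - lift (piQ s) = piJ q.
  have [r Qsr] := surjQ s; exists (s - f r) => //.
  by rewrite (piQE _ _ Qsr) [lift _]liftE rmorphB.
have piJ_lift : piJ =1 lift \o piQ.
  apply: unramified_rmorphism_unique => [r|y z] /=; first by rewrite [lift _]liftE.
  have [q Qq ->] := proj_lift y; have [r Qr ->] := proj_lift z.
  rewrite -rmorphM; suff : kernel piJ (q * r) by [].
  by rewrite kerJ; exact: QQJ.
have piQx : piQ x = 0 by suff : kernel piQ x by []; rewrite kerQ.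
by rewrite -kerJ /kernel /= piJ_lift /= piQx rmorph0.
Qed.

Lemma unramified_quotient (A B : comNzRingType) (piA : {rmorphism R -> A})
    (piB : {rmorphism S -> B}) (g : {rmorphism A -> B}) :
  surjective piB -> (forall r, g (piA r) = piB (f r)) -> unramified_ext g.
Proof.
move=> surjB gE M d [dD dM dZ] b; have [s <-] := surjB b.
pose dS x : restr_scalars piB M := d (piB x).
apply: (unr (d := dS)); split=> [x y|x y|r x]; rewrite ?restr_scaleE /dS.
- by rewrite rmorphD dD.
- by rewrite rmorphM dM.
- by rewrite rmorphM -gE dZ.
Qed.

End Unramified.

Lemma det_mx2 (R : comNzRingType) (M : 'M[R]_2) : \det M = M 0 0 * M 1 1 - M 0 1 * M 1 0.
Proof.
rewrite (expand_det_row _ 0) !big_ord_recl big_ord0 /cofactor !det_mx11 !mxE /=.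
have -> : lift 0 0 = 1 :> 'I_2 by apply/val_inj.
have -> : lift 1 0 = 0 :> 'I_2 by apply/val_inj.
by ring.
Qed.

Section Flat.
Variables (R S : comNzRingType) (f : {rmorphism R -> S}).
Hypothesis flat : flat_ext f.

(* Flatness writes [x_i = sum_j a_ij y_j] with [sum_i r_i a_ij = 0]. If [y_j] is
   [t_kj] modulo [Q_k], then [x_i] is [(a t^T)_ik] modulo [Q_k] and [r (a t^T) = 0]. *)
Lemma flat_relation_det n (r : 'I_n -> R) (x : 'I_n -> S) (Q : 'I_n -> set S) :
  (forall k, is_ideal (Q k)) -> (forall k, residue_surj f (Q k)) ->
  \sum_i f (r i) * x i = 0 ->
  exists rho : 'M[R]_n, (forall i k, Q k (x i - f (rho i k))) /\
    forall i, \det rho * r i = 0.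
Proof.
move=> iQ surjQ /flat[m [a [y [xE ra0]]]].
have /choice[t tP] kj : exists t, Q kj.1 (y kj.2 - f t) by exact: surjQ.
pose rho := \matrix_(i, k) \sum_j a i j * t (k, j) : 'M[R]_n.
exists rho; split=> [i k|i].
  rewrite xE mxE rmorph_sum -sumrB; apply: ideal_sum => // j _.
  by rewrite rmorphM -mulrBr; apply: idealMl => //; exact: tP (k, j).
have rho0 : \row_i r i *m rho = 0.
  apply/rowP => k; rewrite !mxE; under eq_bigr do rewrite !mxE mulr_sumr.
  rewrite exchange_big big1 // => j _ /=.
  by under eq_bigr do rewrite mulrA; rewrite -mulr_suml ra0 mul0r.
have : \row_i r i *m (rho *m \adj rho) = 0 by rewrite mulmxA rho0 mul0mx.
by rewrite mul_mx_adj mul_mx_scalar => /rowP/(_ i); rewrite !mxE.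
Qed.

Lemma flat_annihilator (Q : set S) r x : is_ideal Q -> residue_surj f Q ->
  f r * x = 0 -> exists2 w, Q (x - f w) & w * r = 0.
Proof.
move=> iQ surjQ rx0.
have [//|//||rho [xrho rhor]] := flat_relation_det (r := fun _ : 'I_1 => r)
  (x := fun=> x) (Q := fun=> Q); first by rewrite big_ord1.
by exists (rho 0 0); [exact: xrho | have := rhor 0; rewrite det_mx11].
Qed.

Lemma flat_conductor_sep (Q1 Q2 : set S) c s : is_prime Q1 -> is_prime Q2 ->
  f @^-1` Q1 = f @^-1` Q2 -> residue_surj f Q1 -> residue_surj f Q2 ->
  Q1 s -> ~ Q2 s -> conductor f c -> exists2 w, ~ Q1 (f w) & w * c = 0.
Proof.
move=> pQ1 pQ2 Q12 surj1 surj2 Q1s nQ2s /(_ s)[r fr].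
have Q12E w : Q1 (f w) = Q2 (f w) := congr1 (@^~ w) Q12.
have [i1 i2] := (prime_ideal pQ1, prime_ideal pQ2).
pose Q (k : 'I_2) := if k == 0 then Q1 else Q2.
have [||| rho [xrho rhoc]] := flat_relation_det (Q := Q)
    (r := fun i => if i == 0 then c else - r) (x := fun i => if i == 0 then s else 1).
- by move=> k; rewrite /Q; case: ifP.
- by move=> k; rewrite /Q; case: ifP.
- by rewrite !big_ord_recl big_ord0 /= -fr rmorphN mulr1 addr0 subrr.
exists (\det rho); last exact: (rhoc 0).
have Q1_00 : Q1 (f (rho 0 0)) by apply/(ideal_congr i1 (xrho 0 0)).
have nQ1_01 : ~ Q1 (f (rho 0 1)).
  by rewrite Q12E => /(ideal_congr i2 (xrho 0 1)).
have nQ1_10 : ~ Q1 (f (rho 1 0)) by move/(ideal_congr i1 (xrho 1 0)); exact: prime1.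
rewrite det_mx2 rmorphB !rmorphM => Q1det.
apply: (prime_notM pQ1 nQ1_01 nQ1_10).
by apply/(ideal_congr i1 Q1det); exact: idealMr.
Qed.

Lemma flat_conductor (Q1 Q2 : set S) c : is_prime Q1 -> is_prime Q2 -> Q1 <> Q2 ->
  f @^-1` Q1 = f @^-1` Q2 -> residue_surj f Q1 -> residue_surj f Q2 ->
  conductor f c -> exists2 w, ~ Q1 (f w) & w * c = 0.
Proof.
move=> pQ1 pQ2 /neq_set_sep[] [s Qs nQs] Q12 surj1 surj2 Cc.
  exact: (flat_conductor_sep pQ1 pQ2 Q12 surj1 surj2 Qs nQs).
have [w nQ2w wc] := flat_conductor_sep pQ2 pQ1 (esym Q12) surj2 surj1 Qs nQs Cc.
have Q12w : Q1 (f w) = Q2 (f w) := congr1 (@^~ w) Q12.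
by exists w => //; rewrite Q12w.
Qed.

Lemma flat_quotient (A B : comNzRingType) (piA : {rmorphism R -> A})
    (piB : {rmorphism S -> B}) (g : {rmorphism A -> B}) :
  surjective piA -> surjective piB -> kernel piB `<=` f @` kernel piA ->
  (forall r, g (piA r) = piB (f r)) -> flat_ext g.
Proof.
move=> surjA surjB kerB gE n a b ab0.
have /choice[r ra] i := surjA (a i); have /choice[s sb] i := surjB (b i).
have [|c c0 fc] := kerB (\sum_i f (r i) * s i).
  rewrite /kernel /= rmorph_sum -[RHS]ab0; apply: eq_bigr => i _.
  by rewrite rmorphM -gE ra sb.
have [|m [alpha [y [xE ra0]]]] := flat (n := n.+1)
    (r := fun i => if unlift ord0 i is Some j then r j else - c)
    (x := fun i => if unlift ord0 i is Some j then s j else 1).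
  rewrite big_ord_recl unlift_none; under eq_bigr do rewrite liftK.
  by rewrite -fc rmorphN mulr1 addNr.
exists m, (fun i j => piA (alpha (lift ord0 i) j)), (piB \o y); split=> [i|j].
  have := xE (lift ord0 i); rewrite liftK -sb => ->; rewrite rmorph_sum.
  by apply: eq_bigr => j _; rewrite rmorphM -gE.
have := congr1 piA (ra0 j); rewrite big_ord_recl unlift_none rmorphD rmorphM.
rewrite rmorphN c0 oppr0 mul0r add0r rmorph0 rmorph_sum => ra0'.
by rewrite -[RHS]ra0'; apply: eq_bigr => i _; rewrite liftK rmorphM ra.
Qed.

End Flat.

(** * Subalgebras and module-finite extensions *)

Section Extensions.
Variables (R S : comNzRingType) (f : {rmorphism R -> S}).
Implicit Types (T : set S) (x y : S).

Section Closure.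
Variable T : set S.
Hypothesis sT : is_subalgebra f T.

Lemma subalgebra_base r : T (f r).
Proof. by case: sT. Qed.

Lemma subalgebra0 : T 0.
Proof. by rewrite -(rmorph0 f); exact: subalgebra_base. Qed.

Lemma subalgebra1 : T 1.
Proof. by rewrite -(rmorph1 f); exact: subalgebra_base. Qed.

Lemma subalgebraD x y : T x -> T y -> T (x + y).
Proof. by case: sT => _ TD _ _; exact: TD. Qed.

Lemma subalgebraN x : T x -> T (- x).
Proof. by case: sT => _ _ TN _; exact: TN. Qed.

Lemma subalgebraM x y : T x -> T y -> T (x * y).
Proof. by case: sT => _ _ _; apply. Qed.

Lemma subalgebraB x y : T x -> T y -> T (x - y).
Proof. by move=> Tx Ty; apply: subalgebraD => //; exact: subalgebraN. Qed.

Lemma subalgebra_sum (K : Type) (s : seq K) (P : pred K) (F : K -> S) :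
  (forall k, P k -> T (F k)) -> T (\sum_(k <- s | P k) F k).
Proof. by apply: big_ind; [exact: subalgebra0 | exact: subalgebraD]. Qed.

Lemma subalgebra_prod (K : Type) (s : seq K) (P : pred K) (F : K -> S) :
  (forall k, P k -> T (F k)) -> T (\prod_(k <- s | P k) F k).
Proof. by apply: big_ind; [exact: subalgebra1 | exact: subalgebraM]. Qed.

Lemma subalgebraX x n : T x -> T (x ^+ n).
Proof.
move=> Tx; elim: n => [|n IHn]; first exact: subalgebra1.
by rewrite exprS; exact: subalgebraM.
Qed.

Lemma subalgebra_mmap n (x : 'I_n -> S) (p : mpoly.mpoly n R) :
  (forall i, T (x i)) -> T (mpoly.mmap f x p).
Proof.
move=> Tx; apply: subalgebra_sum => m _; apply: subalgebraM; first exact: subalgebra_base.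
by apply: subalgebra_prod => i _; exact: subalgebraX.
Qed.

Definition colon_ideal x : set R := [set r | T (f r * x)].

Lemma colon_ideal_ideal x : is_ideal (colon_ideal x).
Proof.
split; rewrite /colon_ideal /=; first by rewrite rmorph0 mul0r; exact: subalgebra0.
- by move=> a b Ta Tb; rewrite rmorphD mulrDl; exact: subalgebraD.
- move=> a b Tb; rewrite rmorphM -mulrA.
  by apply: subalgebraM => //; exact: subalgebra_base.
Qed.

End Closure.

Lemma FIP_ext_finiteP : FIP_ext f <-> finite_set (is_subalgebra f).
Proof.
rewrite finite_set_enumP; split=> -[n [Ts TsP]]; exists n, Ts => T /TsP[i Ti];
  by exists i; exact/same_setE.
Qed.

Definition submodule (V : set S) : Prop :=
  [/\ V 0, forall x y, V x -> V y -> V (x + y) & forall r x, V x -> V (f r * x)].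

Fixpoint span (G : seq S) : set S :=
  if G is x :: G' then [set s | exists r t, span G' t /\ s = f r * x + t] else [set 0].

Lemma span_submodule G : submodule (span G).
Proof.
elim: G => [|x G [V0 VD VM]]; split=> /=.
- by [].
- by move=> _ _ -> ->; rewrite addr0.
- by move=> r _ ->; rewrite mulr0.
- by exists 0, 0; rewrite rmorph0 mul0r addr0.
- move=> _ _ [r [t [Vt ->]]] [r' [t' [Vt' ->]]]; exists (r + r'), (t + t').
  by split; [exact: VD | rewrite rmorphD; ring].
- move=> c _ [r [t [Vt ->]]]; exists (c * r), (f c * t).
  by split; [exact: VM | rewrite rmorphM; ring].
Qed.

Lemma mem_span G x : x \in G -> span G x.
Proof.
elim: G => //= y G IHG; have [V0 _ _] := span_submodule G.
rewrite inE => /predU1P[->|/IHG Gx]; first by exists 1, 0; rewrite rmorph1 mul1r addr0.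
by exists 0, x; rewrite rmorph0 mul0r add0r.
Qed.

Lemma span_min G (V : set S) : submodule V -> (forall x, x \in G -> V x) -> span G `<=` V.
Proof.
move=> [V0 VD VM]; elim: G => [|x G IHG] GV /=; first by move=> _ ->.
move=> _ [r [t [Gt ->]]]; apply: VD; first by apply: VM; apply: GV; exact: mem_head.
by apply: IHG Gt => y yG; apply: GV; rewrite inE yG orbT.
Qed.

Lemma span_sum G (K : Type) (s : seq K) (P : pred K) (F : K -> S) :
  (forall k, P k -> span G (F k)) -> span G (\sum_(k <- s | P k) F k).
Proof. by have [V0 VD _] := span_submodule G; exact: big_ind. Qed.

Lemma span_mulr G G' y : (forall x, x \in G -> span G' (x * y)) ->
  forall s, span G s -> span G' (s * y).
Proof.
have [V0 VD VM] := span_submodule G'.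
apply: span_min; split=> [|a b Va Vb|r a Va] /=.
- by rewrite mul0r.
- by rewrite mulrDl; exact: VD.
- by rewrite -mulrA; exact: VM.
Qed.

Lemma integral_span_power y : integral_ext f ->
  exists D, span [seq y ^+ j | j <- iota 0 D] (y ^+ D).
Proof.
move=> /(_ y)[p [mon_p /rootP py0]]; exists (size p).-1.
have size_p_gt0 : (0 < size p)%N by rewrite size_poly_gt0 monic_neq0.
have [_ _ VM] := span_submodule [seq y ^+ j | j <- iota 0 (size p).-1].
have -> : y ^+ (size p).-1 = \sum_(j < (size p).-1) f (- p`_j) * y ^+ j.
  move: py0; rewrite (horner_coef_wide (n := size p)) ?size_poly //.
  rewrite -[in LHS](prednK size_p_gt0) big_ord_recr /= coef_map /= -lead_coefE.
  rewrite (monicP mon_p) rmorph1 mul1r addrC => /eqP; rewrite addr_eq0 => /eqP ->.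
  by rewrite -sumrN; apply: eq_bigr => j _; rewrite coef_map rmorphN mulNr.
apply: span_sum => j _; apply: VM; apply: mem_span.
by apply: map_f; rewrite mem_iota add0n ltn_ord.
Qed.

Lemma integral_stable_span (xs : seq S) : integral_ext f ->
  exists G, span G 1 /\ forall x, x \in xs -> forall s, span G s -> span G (s * x).
Proof.
move=> intf; elim: xs => [|y xs [G [G1 Gxs]]].
  by exists [:: 1]; split=> //; apply: mem_span; exact: mem_head.
have [D yD] := integral_span_power y intf.
pose G' := [seq z * y ^+ j | z <- G, j <- iota 0 D]; exists G'.
have G'X j s : (j < D)%N -> span G s -> span G' (s * y ^+ j).
  move=> jD; apply: span_mulr => z zG; apply: mem_span.
  by apply: (allpairs_f (fun z j => z * y ^+ j)) => //; rewrite mem_iota add0n.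
have G'D s : span G s -> span G' (s * y ^+ D).
  move=> Gs; rewrite mulrC; apply: span_mulr yD => _ /mapP[j + ->].
  by rewrite mem_iota add0n mulrC => /andP[_ jD]; exact: G'X.
split.
  case: D @G' yD G'X {G'D} => [|D] G' /= yD G'X.
    by have := oner_neq0 S; rewrite -(expr0 y) yD eqxx.
  by rewrite -[1]mulr1 -(expr0 y); exact: G'X.
move=> x; rewrite inE => x_in; apply: span_mulr => _ /allpairsP[[z j] /= [zG + ->]].
rewrite mem_iota add0n => /andP[_ jD]; case/predU1P: x_in => [->|x_xs].
  rewrite -mulrA -exprSr; have [jD'|Dj] := ltnP j.+1 D.
    by apply: G'X => //; exact: mem_span.
  by have -> : j.+1 = D; [apply/eqP; rewrite eqn_leq jD | apply: G'D; exact: mem_span].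
by rewrite mulrAC; apply: G'X => //; apply: Gxs => //; exact: mem_span.
Qed.

Definition module_finite : Prop := exists G, span G = setT.

Lemma fin_pres_integral_module_finite : fin_pres_ext f -> integral_ext f -> module_finite.
Proof.
move=> [n [x [surj _]]] intf; have [G [G1 Gx]] := integral_stable_span (codom x) intf.
exists G; apply/seteqP; split=> // s _.
pose stab := [set w | forall z, span G z -> span G (z * w)].
have [_ VD VM] := span_submodule G.
have sub_stab : is_subalgebra f stab.
  split=> [r z Gz|v w sv sw z Gz|w sw z Gz|v w sv sw z Gz].
  - by rewrite mulrC; exact: VM.
  - by rewrite mulrDr; apply: VD; [exact: sv | exact: sw].
  - by rewrite mulrN -mulN1r -(rmorph1 f) -rmorphN; apply: VM; exact: sw.
  - by rewrite mulrA; apply: sw; exact: sv.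
have [p <-] := surj s; rewrite -[mpoly.mmap _ _ _]mul1r.
by apply: (subalgebra_mmap sub_stab) => // i; apply: Gx; exact: codom_f.
Qed.

Definition lead_ideal (x : S) (G : seq S) (V : set S) : set R :=
  [set r | exists2 t, span G t & V (f r * x + t)].

Lemma lead_ideal_ideal x G V : submodule V -> is_ideal (lead_ideal x G V).
Proof.
move=> [V0 VD VM]; have [G0 GD GM] := span_submodule G; split.
- by exists 0; rewrite // rmorph0 mul0r addr0.
- move=> a b [t Gt Vt] [u Gu Vu]; exists (t + u); first exact: GD.
  by have := VD _ _ Vt Vu; rewrite addrACA -mulrDl -rmorphD.
- move=> a b [t Gt Vt]; exists (f a * t); first exact: GM.
  by have := VM a _ Vt; rewrite mulrDr mulrA -rmorphM.
Qed.

Lemma submodule_eq_lead x G U V : submodule U -> submodule V ->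
  V `<=` U -> U `<=` span (x :: G) -> U `&` span G = V `&` span G ->
  lead_ideal x G U = lead_ideal x G V -> U = V.
Proof.
move=> [_ UD UM] [_ VD VM] VU UG UVG UVlead; apply/seteqP; split=> // s Us.
have [r [t [Gt st]]] := UG s Us.
have [u Gu Vu] : lead_ideal x G V r by rewrite -UVlead; exists t; rewrite // -st.
have [_ GD GM] := span_submodule G.
have subN (W : set S) z : (forall r x, W x -> W (f r * x)) -> W z -> W (- z).
  by move=> WM /(WM (- 1)); rewrite rmorphN rmorph1 mulN1r.
have -> : s = (f r * x + u) + (s - (f r * x + u)) by ring.
apply: VD => //; suff : (V `&` span G) (s - (f r * x + u)) by case.
rewrite -UVG; split; first by apply: UD => //; apply: subN UM _; exact: VU.
by have -> : s - (f r * x + u) = t - u by [rewrite st; ring]; apply: GD => //; exact: subN.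
Qed.

Lemma artinian_span (G : seq S) (V : nat -> set S) : artinian R ->
  (forall k, submodule (V k)) -> (forall k, V k.+1 `<=` V k) ->
  (forall k, V k `<=` span G) -> exists N, forall k, (N <= k)%N -> V k = V N.
Proof.
move=> artR; elim: G V => [|x G IHG] V sV Vdec VG.
  exists 0%N => k _; apply/seteqP; split=> s /VG ->; by case: (sV k) (sV 0%N) => V0 _ _ [].
have [k|k|k|N_span stable_span] := IHG (fun k => V k `&` span G).
- have [[V0 VD VM] [G0 GD GM]] := (sV k, span_submodule G).
  by split=> [|y z [Vy Gy] [Vz Gz]|r y [Vy Gy]]; split=> //;
    [exact: VD | exact: GD | exact: VM | exact: GM].
- by move=> s [/Vdec].
- by move=> s [].
have [k|k r [t Gt Vt]|N_lead stable_lead] := artR (fun k => lead_ideal x G (V k)).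
- exact: lead_ideal_ideal.
- by exists t => //; exact: Vdec.
set N := maxn N_span N_lead; exists N => k; rewrite geq_max => /andP[N_span_k N_lead_k].
apply/esym/(submodule_eq_lead (x := x) (G := G)) => //.
- have decr m : V (m + N)%N `<=` V N.
    by elim: m => // m IHm s /Vdec/IHm.
  by have := decr (k - N)%N; rewrite subnK // geq_max N_span_k.
- by rewrite !stable_span // leq_max leqnn.
- by rewrite !stable_lead // leq_max leqnn orbT.
Qed.

Lemma module_finite_artinian : artinian R -> module_finite -> artinian S.
Proof.
move=> artR [G spanG] I iI Idec.
apply: (artinian_span (G := G)) => // k; last by rewrite spanG.
split=> [|x y Ix Iy|r x Ix]; [exact: ideal0 | exact: idealD | exact: idealMl].
Qed.

End Extensions.

Lemma module_finite_quotient (R S A B : comNzRingType) (f : {rmorphism R -> S})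
    (piA : {rmorphism R -> A}) (piB : {rmorphism S -> B}) (g : {rmorphism A -> B}) :
  surjective piB -> (forall r, g (piA r) = piB (f r)) ->
  module_finite f -> module_finite g.
Proof.
move=> surjB gE [G spanG]; exists (map piB G); apply/seteqP; split=> // b _.
have [s <-] := surjB b; have [V0 VD VM] := span_submodule g (map piB G).
suff spanV : span f G `<=` piB @^-1` span g (map piB G) by apply: spanV; rewrite spanG.
apply: span_min => [|x xG]; last by apply: mem_span; exact: map_f.
split=> [|x y Vx Vy|r x Vx]; rewrite /preimage /=.
- by rewrite rmorph0.
- by rewrite rmorphD; exact: VD.
- by rewrite rmorphM -gE; exact: VM.
Qed.

(** * Algebras split over the local components of the base *)

(* [B] is the product over [j] of the rings [eps_j B], each of them isomorphic
   to the component [e_(p j) A] through [g]. *)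
Record split_algebra (A B : comNzRingType) (g : {rmorphism A -> B}) (I J : finType)
    (e : I -> A) (eps : J -> B) (p : J -> I) : Prop := SplitAlgebra {
  split_base : local_decomposition 1 e;
  split_total : local_decomposition 1 eps;
  split_over : forall j, g (e (p j)) * eps j = eps j;
  split_surj : forall j b, exists a, b * eps j = g a * eps j;
  split_inj : forall j a, g a * eps j = 0 -> a * e (p j) = 0 }.

Section SplitAlgebraTheory.
Variables (A B : comNzRingType) (g : {rmorphism A -> B}).
Variables (I J : finType) (e : I -> A) (eps : J -> B) (p : J -> I).
Hypothesis splitB : split_algebra g e eps p.
Implicit Types (a c : A) (x y : B) (T : set B) (i : I) (j l m : J) (X : {set J}).

Let decomp_e := split_base splitB.
Let decomp_eps := split_total splitB.
Let local_e i : local_idem (e i). Proof. by case: decomp_e. Qed.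
Let base_idemE := decomp_idemE decomp_e.

Definition coord x j : A := sval (cid (split_surj splitB j x)) * e (p j).

Lemma coord_idem x j : coord x j * e (p j) = coord x j.
Proof. by rewrite /coord -mulrA local_idemM. Qed.

Lemma coordE x j : x * eps j = g (coord x j) * eps j.
Proof.
rewrite /coord rmorphM -mulrA (split_over splitB).
exact: svalP (cid (split_surj splitB j x)).
Qed.

Lemma coord_uniq x j a : x * eps j = g a * eps j -> coord x j = a * e (p j).
Proof.
rewrite [LHS]coordE => /eqP; rewrite -subr_eq0 -mulrBl -rmorphB.
by move=> /eqP/(split_inj splitB)/eqP; rewrite mulrBl coord_idem subr_eq0 => /eqP.
Qed.

Lemma coord_inj x y : coord x =1 coord y -> x = y.
Proof.
move=> xy; rewrite (decomp_sum decomp_eps x) (decomp_sum decomp_eps y).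
by apply: eq_bigr => j _; rewrite (coordE x) (coordE y) xy.
Qed.

Lemma coordD x y j : coord (x + y) j = coord x j + coord y j.
Proof.
rewrite (coord_uniq (a := coord x j + coord y j)); first by rewrite mulrDl !coord_idem.
by rewrite rmorphD !mulrDl -!coordE.
Qed.

Lemma coordM x y j : coord (x * y) j = coord x j * coord y j.
Proof.
rewrite (coord_uniq (a := coord x j * coord y j)); first by rewrite -mulrA coord_idem.
by rewrite rmorphM -[RHS]mulrA -coordE mulrCA -coordE mulrCA mulrA.
Qed.

Lemma coord_base a j : coord (g a) j = a * e (p j).
Proof. exact: coord_uniq. Qed.

Lemma coordN x j : coord (- x) j = - coord x j.
Proof.
by rewrite -mulN1r -(rmorph1 g) -rmorphN coordM coord_base mulN1r mulNr mulrC coord_idem.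
Qed.

Lemma coord0 j : coord 0 j = 0.
Proof. by rewrite -(rmorph0 g) coord_base mul0r. Qed.

Lemma coord_eps l j : coord (eps l) j = if l == j then e (p j) else 0.
Proof.
rewrite (coord_uniq (a := (l == j)%:R)); last first.
  rewrite (decomp_idemE decomp_eps) rmorph_nat.
  by case: eqP => [->|_]; rewrite ?mul1r ?mul0r.
by case: eqP; rewrite ?mul1r ?mul0r.
Qed.

Let coordL := (coordD, coordN, coordM, coord_base, coord_eps).

Lemma coord_prod (K : Type) (s : seq K) (P : pred K) (F : K -> B) m :
  coord (\prod_(k <- s | P k) F k) m = e (p m) * \prod_(k <- s | P k) coord (F k) m.
Proof.
elim/big_rec2: _ => [|k y x _ IH]; first by rewrite -(rmorph1 g) coord_base mulrC.
by rewrite coordM IH mulrCA.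
Qed.

Definition fiber i : {set J} := [set j | p j == i]%SET.

Lemma in_fiberP i j : reflect (p j = i) (j \in fiber i).
Proof. by rewrite inE; exact: eqP. Qed.

Lemma coord_fiber i y j : j \in fiber i -> coord y j * e i = coord y j.
Proof. by move=> /in_fiberP <-; exact: coord_idem. Qed.

Lemma base_idem_coord i j : coord (g (e i)) j = if j \in fiber i then e i else 0.
Proof. by rewrite coord_base base_idemE inE eq_sym. Qed.

Definition slice i T : set B := [set y | T y /\ g (e i) * y = y].

Lemma slice_coord i y j : g (e i) * y = y -> j \notin fiber i -> coord y j = 0.
Proof. by move=> <- /negbTE jni; rewrite coordM base_idem_coord jni mul0r. Qed.

Lemma slice_coord_inj i x y : g (e i) * x = x -> g (e i) * y = y ->
  {in fiber i, coord x =1 coord y} -> x = y.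
Proof.
move=> xi yi xy; apply: coord_inj => j; have [/xy //|ji] := boolP (j \in fiber i).
by rewrite !(slice_coord _ ji).
Qed.

Lemma sum_slices x : x = \sum_i g (e i) * x.
Proof.
by rewrite -mulr_suml -rmorph_sum; case: decomp_e => _ _ ->; rewrite rmorph1 mul1r.
Qed.

Lemma base_idemM i x : g (e i) * (g (e i) * x) = g (e i) * x.
Proof. by rewrite mulrA -rmorphM local_idemM. Qed.

Definition finite_slices i : Prop := finite_set (slice i @` is_subalgebra g).

Lemma finite_subalgebras_of_slices :
  (forall i, finite_slices i) -> finite_set (is_subalgebra g).
Proof.
have sub T T' : is_subalgebra g T -> is_subalgebra g T' ->
    (forall i, slice i T = slice i T') -> T `<=` T'.
  move=> sT sT' TT' x Tx; rewrite [x]sum_slices; apply: (subalgebra_sum sT') => i _.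
  suff : slice i T' (g (e i) * x) by case.
  rewrite -TT'; split; last exact: base_idemM.
  by apply: (subalgebraM sT) => //; exact: subalgebra_base.
move=> fin; apply: (finite_set_inj (h := fun T i => slice i T)); last 1 first.
- exact: finite_families fin.
- move=> T T' sT sT' eqTT'; have TT' i : slice i T = slice i T' := congr1 (@^~ i) eqTT'.
  by apply/seteqP; split; apply: sub.
- by move=> T sT i; exact: imageP.
Qed.

Lemma finite_slices_inj (Y : Type) i (h : set B -> Y) (K : set Y) :
  (forall T T', is_subalgebra g T -> is_subalgebra g T' -> h T = h T' ->
     slice i T `<=` T') ->
  (forall T, is_subalgebra g T -> K (h T)) -> finite_set K -> finite_slices i.
Proof.
move=> h_sub hK finK; apply: (finite_image_factor (h := h)); last first.
  by apply: sub_finite_set finK => _ [T sT <-]; exact: hK.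
move=> T T' sT sT' hTT'; apply/seteqP.
by split=> y [Ty yi]; split=> //; [apply: (h_sub T T') | apply: (h_sub T' T)].
Qed.

Lemma finite_component_slices i : finite_set (pideal (e i)) -> finite_slices i.
Proof.
move=> fin_e; apply: (finite_slices_inj (h := slice i)
  (K := [set V | V `<=` [set y | g (e i) * y = y]])).
- by move=> T T' _ _ -> y [].
- by move=> T _ y [].
apply: finite_subsets.
apply: (finite_set_inj (h := coord)); last exact: finite_families (fun=> fin_e).
  by move=> x y _ _ xy; apply: coord_inj => j; rewrite xy.
move=> y yi j; exists (coord y j); have [ji|ji] := boolP (j \in fiber i).
  by rewrite coord_fiber.
by rewrite (slice_coord yi ji) mul0r.
Qed.

Definition idem_sum X : B := \sum_(j in X) eps j.

Lemma coord_idem_sum X m : coord (idem_sum X) m = if m \in X then e (p m) else 0.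
Proof.
have coord_sum (K : Type) (s : seq K) (P : pred K) (F : K -> B) :
    coord (\sum_(k <- s | P k) F k) m = \sum_(k <- s | P k) coord (F k) m.
  by elim/big_rec2: _ => [|k x y _ <-]; rewrite ?coord0 ?coordD.
rewrite /idem_sum coord_sum; under eq_bigr do rewrite coord_eps.
rewrite -big_mkcondr /=; case: ifP => mX; last first.
  by rewrite big1 // => l /andP[lX /eqP lm]; rewrite -lm lX in mX.
by rewrite (big_pred1 m) => [|l] /=; [|case: eqP => [->|]; rewrite ?mX ?andbF].
Qed.

Definition level i y j : {set J} := [set l in fiber i | coord y j == coord y l]%SET.

Lemma in_level i y j l : (l \in level i y j) = (l \in fiber i) && (coord y j == coord y l).
Proof. by rewrite inE. Qed.

Lemma field_coord_unit i y j l : field_at (e i) -> j \in fiber i -> l \in fiber i ->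
  coord y j != coord y l -> exists d, (coord y j - coord y l) * d * e i = e i.
Proof.
move=> fld ji li yjl; apply: (notnil_at_unit (local_e i)) => /fld.
by rewrite mulrBl !coord_fiber // => /eqP; rewrite subr_eq0 (negbTE yjl).
Qed.

(* Lagrange interpolation *)
Lemma subalgebra_level_idem i T y j : field_at (e i) -> is_subalgebra g T -> T y ->
  j \in fiber i -> T (idem_sum (level i y j)).
Proof.
move=> fld sT Ty ji.
have /choice[d dP] l : exists d, l \in fiber i -> coord y j != coord y l ->
    (coord y j - coord y l) * d * e i = e i.
  have [li|] := boolP (l \in fiber i); last by exists 0.
  have [_|yjl] := eqVneq (coord y j) (coord y l); first by exists 0.
  by have [d dP] := field_coord_unit fld ji li yjl; exists d.
pose F l := (y - g (coord y l)) * g (d l).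
pose others l := (l \in fiber i) && (coord y j != coord y l).
suff -> : idem_sum (level i y j) = g (e i) * \prod_(l | others l) F l.
  apply: (subalgebraM sT); first exact: subalgebra_base.
  apply: (subalgebra_prod sT) => l _; apply: (subalgebraM sT); last exact: subalgebra_base.
  by apply: (subalgebraB sT) => //; exact: subalgebra_base.
apply: coord_inj => m; rewrite coord_idem_sum in_level coordM base_idem_coord coord_prod.
have [mi|] /= := boolP (m \in fiber i); last by rewrite mul0r.
have pm := in_fiberP _ _ mi.
have FE l : coord (F l) m = (coord y m - coord y l) * d l * e i.
  rewrite /F !coordL pm -{1}(coord_fiber y mi); have := local_idemM (local_e i) => ee.
  have -> : (coord y m * e i - coord y l * e i) * (d l * e i)
     = (coord y m - coord y l) * d l * (e i * e i) by ring.
  by rewrite ee.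
rewrite pm mulrA local_idemM //; case: eqP => [jm|/eqP jm].
  apply/esym/(big_ind (fun z => e i * z = e i)) => [|x z xP zP|l /andP[li jl]].
  - by rewrite mulr1.
  - by rewrite mulrA xP zP.
  - by rewrite FE -jm dP // local_idemM.
by rewrite (bigD1 m) /= ?/others ?mi // FE subrr !mul0r mulr0.
Qed.

Lemma slice_sum_levels i y : g (e i) * y = y ->
  y = \sum_(X in preim_partition (coord y) (fiber i)) \sum_(j in X) g (coord y j) * eps j.
Proof.
move=> yi; rewrite -(set_partition_big _ (preim_partitionP _ _)).
rewrite {1}(decomp_sum decomp_eps y) [RHS]big_mkcond; apply: eq_bigr => j _.
by case: ifPn => ji; rewrite coordE // (slice_coord yi ji) rmorph0 mul0r.
Qed.

Lemma field_slices i : field_at (e i) -> finite_slices i.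
Proof.
move=> fld; pose idems T := [set X | `[< T (idem_sum X) >]]%SET.
apply: (finite_slices_inj (h := idems) (K := setT)) => //.
move=> T T' sT sT' idemsTT' y [Ty yi]; rewrite (slice_sum_levels yi).
apply: (subalgebra_sum sT') => _ /imsetP[j ji ->].
have {ji}Tj := subalgebra_level_idem fld sT Ty ji.
have T'j : T' (idem_sum (level i y j)).
  have : level i y j \in idems T by rewrite inE; exact/asboolP.
  by rewrite idemsTT' inE => /asboolP.
rewrite (eq_bigr (fun l => g (coord y j) * eps l)) => [|l]; last first.
  by rewrite inE => /andP[_ /eqP ->].
rewrite -mulr_sumr; apply: (subalgebraM sT') => //; exact: subalgebra_base.
Qed.

Lemma pair_slice_split i j1 j2 y : j1 != j2 -> fiber i = [set j1; j2]%SET ->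
  g (e i) * y = y ->
  y = g (coord y j1 - coord y j2) * eps j1 + g (coord y j2) * g (e i).
Proof.
move=> j12 fibE yi; have ee := local_idemM (local_e i).
have pj1 : p j1 = i by apply/in_fiberP; rewrite fibE !inE eqxx.
have pj2 : p j2 = i by apply/in_fiberP; rewrite fibE !inE eqxx orbT.
apply: coord_inj => j; rewrite !(base_idem_coord, coordL).
have := slice_coord yi (j := j); rewrite fibE !inE.
have [->|_] := eqVneq j j1 => /=.
  by rewrite pj1 -!(mulrA _ (e i)) ee -mulrDl subrK -pj1 coord_idem.
rewrite mulr0 add0r; have [->|_] /= := eqVneq j j2; last first.
  by move=> -> //; rewrite mulr0.
by rewrite pj2 -(mulrA _ (e i)) ee -pj2 coord_idem.
Qed.

Lemma pair_slices i : finite_set (@is_ideal A) -> #|fiber i| = 2%N -> finite_slices i.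
Proof.
move=> fin_ideals /eqP/cards2P[j1 [j2 [j12 fibE]]].
pose colon T := colon_ideal g T (eps j1).
apply: (finite_slices_inj (h := colon) (K := @is_ideal A)) => //.
  move=> T T' sT sT' TT' y [Ty yi]; have yE := pair_slice_split j12 fibE yi.
  have in_sub U : is_subalgebra g U -> U (g (coord y j2) * g (e i)).
    by move=> sU; rewrite -rmorphM; exact: subalgebra_base.
  rewrite yE; apply: (subalgebraD sT'); last exact: in_sub.
  suff : colon T' (coord y j1 - coord y j2) by [].
  rewrite -TT' /colon /colon_ideal /= -[X in T X](addrK (g (coord y j2) * g (e i))) -yE.
  by apply: (subalgebraB sT) => //; exact: in_sub.
by move=> T sT; exact: colon_ideal_ideal.
Qed.

Definition ideal_subalgebra (L : set A) : set B :=
  [set x | exists a, forall j, L (coord x j - a * e (p j))].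

Lemma ideal_subalgebraP L : is_ideal L -> is_subalgebra g (ideal_subalgebra L).
Proof.
move=> iL; split.
- by move=> r; exists r => j; rewrite coord_base subrr; exact: ideal0.
- move=> x y [a xa] [b yb]; exists (a + b) => j.
  by rewrite coordD mulrDl opprD addrACA; exact: idealD.
- move=> x [a xa]; exists (- a) => j.
  by rewrite coordN mulNr -opprD; exact: idealN.
- move=> x y [a xa] [b yb]; exists (a * b) => j; rewrite coordM.
  have -> : coord x j * coord y j - a * b * e (p j)
      = coord y j * (coord x j - a * e (p j)) + a * (coord y j * e (p j) - b * e (p j)).
    ring.
  by rewrite coord_idem; apply: idealD => //; exact: idealMl.
Qed.

Lemma fiber_gt1 i : (forall a, conductor g a -> a = 0) -> (1 < #|fiber i|)%N.
Proof.
move=> cond0; rewrite ltnNge; apply/negP => /card_le1_eqP fiber_le1.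
have [_ /eqP e0 _] := local_e i; apply: e0; apply: cond0 => b.
have [fib0|[j ji]] := set_0Vmem (fiber i).
  by exists 0; apply: (slice_coord_inj (i := i)) => [||l];
    rewrite ?base_idemM ?rmorph0 ?mulr0 // fib0 inE.
have pj := in_fiberP _ _ ji.
exists (coord b j); apply: (slice_coord_inj (i := i)) => [||l li].
- by rewrite -rmorphM mulrC -pj coord_idem.
- exact: base_idemM.
- have -> : l = j by exact: fiber_le1.
  by rewrite coord_base coord_idem coordM base_idem_coord ji -pj mulrC coord_idem.
Qed.

Hypothesis fibers_gt1 : forall i, (1 < #|fiber i|)%N.

Lemma finite_subalgebras_ideals : finite_set (is_subalgebra g) -> finite_set (@is_ideal A).
Proof.
have sub L L' : is_ideal L -> is_ideal L' ->
    ideal_subalgebra L = ideal_subalgebra L' -> L `<=` L'.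
  move=> iL iL' LL' a La; apply: (decomp_ideal decomp_e) => // i.
  have /card_gt1P[j [j' [ji j'i jj']]] := fibers_gt1 i.
  have coord_a l : coord (g a * eps j) l = if j == l then a * e (p l) else 0.
    by rewrite !coordL; case: eqP; rewrite ?mulr0 // -mulrA local_idemM.
  have [b xb] : ideal_subalgebra L' (g a * eps j).
    rewrite -LL'; exists 0 => l; rewrite mul0r subr0 coord_a.
    by case: eqP => _; [exact: idealMr | exact: ideal0].
  have := xb j'; have := xb j; rewrite !coord_a eqxx (negbTE jj').
  rewrite (in_fiberP _ _ ji) (in_fiberP _ _ j'i) sub0r => Lj Lj'.
  by rewrite -(subrK (b * e i) (a * e i)) -[X in L' (_ + X)]opprK; exact: idealB.
move=> fin; apply: (finite_set_inj (h := ideal_subalgebra)) fin.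
  by move=> L L' iL iL' LL'; apply/seteqP; split; apply: sub.
exact: ideal_subalgebraP.
Qed.

Definition square_zero_subalgebra q w : set B :=
  [set x | exists r s, x = g r + g (s * q) * w].

Lemma square_zero_subalgebraP q w : q * q = 0 -> is_subalgebra g (square_zero_subalgebra q w).
Proof.
move=> qq; split.
- by move=> r; exists r, 0; rewrite mul0r rmorph0 mul0r addr0.
- move=> _ _ [r [s ->]] [r' [s' ->]]; exists (r + r'), (s + s').
  by rewrite mulrDl !rmorphD; ring.
- by move=> _ [r [s ->]]; exists (- r), (- s); rewrite mulNr !rmorphN; ring.
- move=> _ _ [r [s ->]] [r' [s' ->]]; exists (r * r'), (r * s' + r' * s).
  have gqq : g q * g q = 0 by rewrite -rmorphM qq rmorph0.
  rewrite !(rmorphM, rmorphD).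
  have -> : (g r + g s * g q * w) * (g r' + g s' * g q * w)
     = g r * g r' + (g r * g s' + g r' * g s) * g q * w
       + (g q * g q) * (g s * g s' * w * w) by ring.
  by rewrite gqq mul0r addr0.
Qed.

(* The third component forces the coefficient of [1] to vanish, and the first one
   then forces [q w_u = q w_v], where [w_u = eps_1 + u eps_2]. *)
Lemma square_zero_subalgebra_inj i q u v j1 j2 j3 : q * e i = q ->
  j1 \in fiber i -> j2 \in fiber i -> j3 \in fiber i -> j1 != j2 -> j2 != j3 -> j3 != j1 ->
  square_zero_subalgebra q (eps j1 + g u * eps j2)
    `<=` square_zero_subalgebra q (eps j1 + g v * eps j2) -> q * u = q * v.
Proof.
move=> qe /in_fiberP pj1 /in_fiberP pj2 /in_fiberP pj3 j12 j23 j31.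
have q_in :
    square_zero_subalgebra q (eps j1 + g u * eps j2) (g q * (eps j1 + g u * eps j2)).
  by exists 0, 1; rewrite mul1r rmorph0 add0r.
move=> /(_ _ q_in)[r [s xE]]; have coordx j := congr1 (coord^~ j) xE.
have ee := local_idemM (local_e i).
have qM c : q * e i * (c * e i * e i) = q * c by rewrite qe -mulrA ee mulrCA qe mulrC.
have sqM c : s * q * e i * (c * e i * e i) = s * q * c.
  by rewrite -(mulrA s q) -(mulrA s (q * e i)) qM mulrA.
have re : r * e i = 0.
  have := coordx j3; rewrite !coordL pj3 [j1 == j3]eq_sym (negbTE j31) (negbTE j23).
  by rewrite !mulr0 !addr0 !mulr0 addr0.
have qsq : q = s * q.
  have := coordx j1; rewrite !coordL pj1 eqxx [j2 == j1]eq_sym (negbTE j12) re add0r.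
  by rewrite !mulr0 !addr0 -[s * q * e i]mulrA !qe -mulrA qe.
have := coordx j2; rewrite !coordL pj2 eqxx (negbTE j12) re !add0r.
by rewrite qM sqM -qsq.
Qed.

Lemma SPIR_fiber_le2 i : artinian A -> finite_set (is_subalgebra g) -> SPIR_at (e i) ->
  ~ finite_set (pideal (e i)) -> (#|fiber i| <= 2)%N.
Proof.
move=> artA fin spir inf_e; rewrite leqNgt; apply/negP => /card_gt2P.
move=> [j1 [j2 [j3 [[j1i j2i j3i] [j12 j23 j31]]]]]; apply: inf_e.
apply: (residue_finite_component (finite_subalgebras_ideals fin) artA).
have [q [q0 qe qq]] := SPIR_at_square_zero (local_e i) spir.
pose alg u := square_zero_subalgebra q (eps j1 + g u * eps j2).
apply: (finite_image_factor (h := alg)); last first.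
  by apply: sub_finite_set fin => _ [u _ <-]; exact: square_zero_subalgebraP.
move=> u v _ _ uv; apply: eq_residue_coset; apply: contrapT.
move=> /(notnil_at_unit (local_e i))[c uvc]; apply: q0.
have quv : q * u = q * v.
  apply: (square_zero_subalgebra_inj qe j1i j2i j3i j12 j23 j31).
  by rewrite -/(alg u) uv.
rewrite -qe -uvc; have -> : q * ((u - v) * c * e i) = (q * u - q * v) * (c * e i) by ring.
by rewrite quv subrr mul0r.
Qed.

Theorem finite_subalgebras_split : artinian A ->
  finite_set (is_subalgebra g) <-> finite_set (@is_ideal A) /\
    forall i, SPIR_at (e i) -> ~ finite_set (pideal (e i)) -> #|fiber i| = 2%N.
Proof.
move=> artA; split=> [fin|[fin_ideals two]].
  split=> [|i spir inf_e]; first exact: finite_subalgebras_ideals.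
  by apply/eqP; rewrite eqn_leq fibers_gt1 andbT; exact: SPIR_fiber_le2.
apply: finite_subalgebras_of_slices => i.
have [fin_e|inf_e] := pselect (finite_set (pideal (e i))).
  exact: finite_component_slices.
have [fld|nfld] := pselect (field_at (e i)); first exact: field_slices.
by apply: pair_slices => //; apply: two => //; exact: infinite_component_SPIR.
Qed.

Lemma preimage_nil_at j : g @^-1` nil_at (eps j) = nil_at (e (p j)).
Proof.
apply/seteqP; split=> a [k ak]; exists k.
  by apply: (split_inj splitB); rewrite rmorphXn.
by rewrite -rmorphXn -(split_over splitB) mulrA -rmorphM ak rmorph0 mul0r.
Qed.

Lemma primes_over_nil_at i :
  primes_over g (nil_at (e i)) = (fun j => nil_at (eps j)) @` [set` fiber i].
Proof.
have local_eps j : local_idem (eps j) by case: decomp_eps.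
apply/seteqP; split=> [Q [pQ]|_ [j ji <-]]; last first.
  split; first exact: nil_at_prime.
  by rewrite preimage_nil_at (in_fiberP _ _ ji).
have [j ->] := decomp_prime decomp_eps pQ.
rewrite preimage_nil_at => /(nil_at_inj decomp_e) ji.
by exists j => //; exact/in_fiberP.
Qed.

Lemma two_primes_over_nil_at i :
  two_primes_over g (nil_at (e i)) <-> #|fiber i| = 2%N.
Proof.
rewrite two_primes_overP primes_over_nil_at -is_pair_finset.
exact/is_pair_image/(nil_at_inj decomp_eps).
Qed.

End SplitAlgebraTheory.

(** * Unramified extensions of Artinian rings *)

Section UnramifiedComponent.
Variables (A B : comNzRingType) (g : {rmorphism A -> B}) (eps : B).
Hypotheses (artB : artinian B) (unr : unramified_ext g) (local_eps : local_idem eps).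
Implicit Types (b x y z : B) (L : set B).

Let Q : set B := nil_at eps.
Let iQ : is_ideal Q. Proof. exact: nil_at_ideal. Qed.

Hypothesis surjQ : residue_surj g Q.

Definition component_image : set B := [set b | exists a, b * eps = g a * eps].
Let V := component_image.

Lemma component_image_subalgebra : is_subalgebra g V.
Proof.
split=> [a|x y [a xa] [b yb]|x [a xa]|x y [a xa] [b yb]]; first by exists a.
- by exists (a + b); rewrite rmorphD !mulrDl xa yb.
- by exists (- a); rewrite rmorphN !mulNr xa.
- by exists (a * b); rewrite rmorphM -mulrA yb mulrCA xa mulrCA mulrA.
Qed.

Let sV := component_image_subalgebra.

(* The ideal [(V & L) + Q L]; it contains the multiples of [V & L] because [B = V + Q]. *)
Definition mod_maximal L : set B :=
  [set x | exists v, [/\ V v, L v & prod_ideal Q L (x - v)]].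

Lemma mod_maximal_ideal L : is_ideal L -> is_ideal (mod_maximal L).
Proof.
move=> iL; have iQL := prod_ideal_ideal Q L; split.
- exists 0; rewrite subrr; split; [|exact: ideal0 | exact: (ideal0 iQL)].
  exact: (subalgebra0 sV).
- move=> x y [v [Vv Lv xv]] [w [Vw Lw yw]]; exists (v + w).
  rewrite opprD addrACA.
  by split; [exact: (subalgebraD sV) | exact: idealD | exact: (idealD iQL)].
- move=> b x [v [Vv Lv xv]]; have [a Qba] := surjQ b; exists (g a * v); split.
  + by apply: (subalgebraM sV) => //; exact: (subalgebra_base sV).
  + exact: idealMl.
  + have -> : b * x - g a * v = (b - g a) * v + b * (x - v) by ring.
    by apply: (idealD iQL); [exact: prod_idealM | exact: (idealMl _ iQL)].
Qed.

Lemma unramified_mod_maximal : Q `<=` mod_maximal Q.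
Proof.
apply: (unramified_ideal unr (nil_at_prime local_eps) surjQ) => [|x y Qx Qy|a Qa].
- exact: mod_maximal_ideal.
- exists 0; rewrite subr0; split; [|exact: ideal0 | exact: prod_idealM].
  exact: (subalgebra0 sV).
- exists (g a); rewrite subrr; split=> //; first exact: (subalgebra_base sV).
  exact: (ideal0 (prod_ideal_ideal Q Q)).
Qed.

Lemma ideal_power_mod_maximal n : ideal_power Q n `<=` mod_maximal (ideal_power Q n).
Proof.
elim: n => [b _|n IHn].
  have [a Qba] := surjQ b; exists (g a); split=> //; first exact: (subalgebra_base sV).
  by rewrite -[b - g a]mulr1; exact: prod_idealM.
apply: prod_ideal_min => [|y z /unramified_mod_maximal[v [Vv Qv yv]]].
  exact/mod_maximal_ideal/ideal_power_ideal.
move=> Lz; have [w [Vw Lw zw]] := IHn z Lz; exists (v * w); split.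
- exact: (subalgebraM sV).
- exact: prod_idealM.
- have -> : y * z - v * w = v * (z - w) + (y - v) * z by ring.
  apply: (idealD (prod_ideal_ideal _ _)); [exact: prod_idealM | exact: prod_idealA].
Qed.

Lemma unramified_component_surj b : exists a, b * eps = g a * eps.
Proof.
have [n nilQ] := nil_at_nilpotent artB eps.
suff [v [a va] Lbv] : exists2 v, V v & ideal_power Q n (b - v).
  by exists a; rewrite -va; apply/eqP; rewrite -subr_eq0 -mulrBl nilQ.
elim: n {nilQ} => [|n [v Vv Lbv]].
  by exists 0 => //; exact: (subalgebra0 sV).
have [w [Vw _ bvw]] := ideal_power_mod_maximal Lbv.
by exists (v + w); [exact: (subalgebraD sV) | rewrite opprD addrA].
Qed.

End UnramifiedComponent.

(* The properties of [R/(R:S) -> S/(R:S)] on which the theorem depends. *)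
Record nucleus_extension (A B : comNzRingType) (g : {rmorphism A -> B}) : Prop :=
  NucleusExtension {
    nucleus_artinian : artinian A;
    nucleus_target_artinian : artinian B;
    nucleus_flat : flat_ext g;
    nucleus_unramified : unramified_ext g;
    nucleus_residue_surj : forall Q, is_prime Q -> residue_surj g Q;
    nucleus_conductor : forall a, conductor g a -> a = 0 }.

Section NucleusExtension.
Variables (A B : comNzRingType) (g : {rmorphism A -> B}).
Hypothesis nucleus_g : nucleus_extension g.

Lemma component_lies_over (I J : finType) (e : I -> A) (eps : J -> B) :
  local_decomposition 1 e -> local_decomposition 1 eps ->
  forall j, exists i, g (e i) * eps j = eps j.
Proof.
move=> [local_e _ e1] [local_eps _ _] j; have pQ := nil_at_prime (local_eps j).
have [i ni] : exists i, ~ nil_at (eps j) (g (e i)).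
  apply/existsNP => nil_e; apply: (prime1 pQ).
  by rewrite -(rmorph1 g) -e1 rmorph_sum; apply: ideal_sum => //; exact: prime_ideal.
exists i; have [b ub] := notnil_at_unit (local_eps j) ni.
by rewrite -{1}ub -[RHS]ub !mulrA -rmorphM local_idemM.
Qed.

Lemma exists_split_algebra : exists (I J : finType) (e : I -> A) (eps : J -> B) (p : J -> I),
  split_algebra g e eps p.
Proof.
have [artA artB flat unr residue _] := nucleus_g.
have [I [e decomp_e]] := local_decomposition_idem artA (mulr1 1).
have [J [eps decomp_eps]] := local_decomposition_idem artB (mulr1 1).
have /choice[p pP] := component_lies_over decomp_e decomp_eps.
have [[local_e _ _] [local_eps _ _]] := (decomp_e, decomp_eps).
exists I, J, e, eps, p; split=> // [j b|j a ga].
  by apply: unramified_component_surj => //; exact/residue/nil_at_prime.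
have pQ := nil_at_prime (local_eps j); have iQ := prime_ideal pQ.
have [w Qw wa] := flat_annihilator flat iQ (residue _ pQ) ga.
have [|c wc] := notnil_at_unit (local_e (p j)) (a := w).
  move=> [k wk]; apply: (local_idem_notnil (local_eps j)); apply/(ideal_congr iQ Qw).
  by exists k; rewrite -rmorphXn -(pP j) mulrA -rmorphM wk rmorph0 mul0r.
have -> : a * e (p j) = w * a * c * e (p j) by rewrite -{1}wc; ring.
by rewrite wa !mul0r.
Qed.

Lemma nucleus_primes_over (M : set A) : is_prime M ->
  exists Q1 Q2, [/\ Q1 <> Q2, primes_over g M Q1 & primes_over g M Q2].
Proof.
have [I [J [e [eps [p splitB]]]]] := exists_split_algebra.
move=> /(decomp_prime (split_base splitB))[i ->]; rewrite (primes_over_nil_at splitB).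
have /card_gt1P[j [j' [ji j'i jj']]] := fiber_gt1 splitB i (nucleus_conductor nucleus_g).
exists (nil_at (eps j)), (nil_at (eps j')); split.
- by move/(nil_at_inj (split_total splitB))/eqP; rewrite (negbTE jj').
- by exists j.
- by exists j'.
Qed.

Theorem nucleus_FIP : finite_set (is_subalgebra g) <->
  finite_set (@is_ideal A) /\
  (forall M, is_prime M -> loc_SPIR M -> loc_infinite M -> two_primes_over g M).
Proof.
have [I [J [e [eps [p splitB]]]]] := exists_split_algebra.
have [local_e _ _] := split_base splitB.
have fibers_gt1 i : (1 < #|fiber p i|)%N.
  exact: fiber_gt1 splitB i (nucleus_conductor nucleus_g).
rewrite (finite_subalgebras_split splitB fibers_gt1 (nucleus_artinian nucleus_g)).
split=> -[fin two]; split=> //.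
  move=> M /(decomp_prime (split_base splitB))[i ->].
  move=> /(loc_SPIR_nil_at (local_e i)) spir /(loc_infinite_nil_at (local_e i)) inf_e.
  exact/(two_primes_over_nil_at splitB)/two.
move=> i /(loc_SPIR_nil_at (local_e i)) spir /(loc_infinite_nil_at (local_e i)) inf_e.
by apply/(two_primes_over_nil_at splitB)/two => //; exact: nil_at_prime.
Qed.

End NucleusExtension.

(** * Passage to the nucleus *)

Section LocalizationOfQuotient.
Variables (R A : comNzRingType) (pi : {rmorphism R -> A}) (N : set A).
Hypothesis pi_surj : surjective pi.
Hypothesis primeN : is_prime N.

Let M : set R := pi @^-1` N.

Hypothesis ker_killed : forall c, kernel pi c -> exists2 w, ~ M w & w * c = 0.

Lemma loc_eq_quotient a u b v :
  loc_eq M a u b v <-> loc_eq N (pi a) (pi u) (pi b) (pi v).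
Proof.
split=> [[w [Mw wz]]|[x []]].
  by exists (pi w); split; rewrite // -!rmorphM -rmorphB -rmorphM wz rmorph0.
have [w <-] := pi_surj x; rewrite -!rmorphM -rmorphB -rmorphM => Nw /ker_killed[t Mt twz].
exists (t * w); split; last by rewrite -mulrA.
exact: prime_notM (preimage_prime pi primeN) Mt Nw.
Qed.

Lemma loc_infinite_quotient : loc_infinite M <-> loc_infinite N.
Proof.
split=> inf n a u Nu; last first.
  have [i|x [y [Nv bv]]] := inf n (pi \o a) (pi \o u); first exact: Nu.
  have [[b bx] [v vy]] := (pi_surj x, pi_surj y); exists b, v.
  split; first by rewrite /M /preimage /= vy.
  by move=> i /loc_eq_quotient; rewrite bx vy; exact: bv.
have /choice[a' aE] i := pi_surj (a i); have /choice[u' uE] i := pi_surj (u i).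
have [i|b [v [Mv bv]]] := inf n a' u'; first by rewrite /M /preimage /= uE; exact: Nu.
exists (pi b), (pi v); split=> // i; rewrite -aE -uE => /loc_eq_quotient; exact: bv.
Qed.

Lemma loc_SPIR_quotient : loc_SPIR M <-> loc_SPIR N.
Proof.
have zeroE m : loc_eq M m 1 0 1 <-> loc_eq N (pi m) 1 0 1.
  by rewrite loc_eq_quotient rmorph0 rmorph1.
have multE m a p u : loc_eq M m 1 (a * p) u <-> loc_eq N (pi m) 1 (pi a * pi p) (pi u).
  by rewrite loc_eq_quotient rmorphM rmorph1.
split=> [[[m [Mm m0]] [p [n [Mp [gen pn]]]]]|[[x [Nx x0]] [y [n [Ny [gen yn]]]]]].
  split; first by exists (pi m); split=> // /zeroE.
  exists (pi p), n; split=> //; split; last by rewrite -rmorphXn; exact/zeroE.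
  move=> x; have [m' <-] := pi_surj x => /gen[a [u [Mu e]]].
  by exists (pi a), (pi u); split=> //; exact/multE.
have [[m mx] [p py]] := (pi_surj x, pi_surj y); subst x y.
split; first by exists m; split=> // /zeroE.
exists p, n; split=> //; split; last by apply/zeroE; rewrite rmorphXn.
move=> m' /gen[b [v [Nv e]]]; have [[a ab] [u uv]] := (pi_surj b, pi_surj v); subst b v.
by exists a, u; split=> //; exact/multE.
Qed.

End LocalizationOfQuotient.

Section Conductor.
Variables (R S : comNzRingType) (f : {rmorphism R -> S}).

Lemma conductor_ideal : is_ideal (conductor f).
Proof.
split=> [s|x y Cx Cy s|a x Cx s]; first by exists 0; rewrite rmorph0 mul0r.
- have [[a ax] [b yb]] := (Cx s, Cy s).
  by exists (a + b); rewrite !rmorphD mulrDl ax yb.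
- by have [b xb] := Cx s; exists (a * b); rewrite !rmorphM xb mulrA.
Qed.

Lemma image_conductor_ideal : is_ideal (f @` conductor f).
Proof.
have iC := conductor_ideal; split.
- by exists 0; [exact: (ideal0 iC) | rewrite rmorph0].
- by move=> _ _ [x Cx <-] [y Cy <-]; exists (x + y); [exact: (idealD iC) | rewrite rmorphD].
- move=> s _ [c Cc <-]; have [r rE] := Cc s; exists r; last by rewrite rE mulrC.
  by move=> t; have [r' r'E] := Cc (s * t); exists r'; rewrite r'E rE mulrA.
Qed.

Lemma in_supp_conductor (M : set R) : in_supp f M -> conductor f `<=` M.
Proof. by move=> [_ [s sM]] c Cc; apply: contrapT => /sM; apply; exact: Cc. Qed.

(* [Q1] and [Q2] are separated by some [s], and [u s] in [f(R)] forces [u] in [M]. *)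
Lemma primes_over_in_supp (M : set R) (Q1 Q2 : set S) : is_prime M -> Q1 <> Q2 ->
  primes_over f M Q1 -> primes_over f M Q2 -> in_supp f M.
Proof.
move=> pM Q12 over1 over2; split=> //.
have supp P P' s : primes_over f M P -> primes_over f M P' -> P s -> ~ P' s ->
    forall u, ~ M u -> ~ exists r, f r = f u * s.
  move=> [pP PM] [pP' P'M] Ps nP's u Mu [r fr].
  have : M r by rewrite -PM /preimage /= fr; apply: idealMl => //; exact: prime_ideal.
  rewrite -P'M /preimage /= fr; apply: prime_notM => //.
  by suff : ~ (f @^-1` P') u by []; rewrite P'M.
have [[s Qs nQs]|[s Qs nQs]] := neq_set_sep Q12; exists s.
  exact: supp over1 over2 Qs nQs.
exact: supp over2 over1 Qs nQs.
Qed.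

Lemma conductor_full : conductor f 1 ->
  finite_set (is_subalgebra f) /\ finite_set (ideal_above (conductor f)).
Proof.
move=> C1; split; apply: sub_finite_set (finite_set1 setT).
  move=> T sT; apply/seteqP; split=> // s _; have [r] := C1 s.
  by rewrite rmorph1 mul1r => <-; exact: (subalgebra_base sT).
move=> L [iL CL]; apply/seteqP; split=> // r _.
by rewrite -[r]mulr1; apply: idealMl => //; exact: CL.
Qed.

End Conductor.

(* The square [R -> S], [R/C -> S/C] for [C = (R:S)], an ideal of both rings. *)
Record conductor_square (R S A B : comNzRingType) (f : {rmorphism R -> S})
    (piA : {rmorphism R -> A}) (piB : {rmorphism S -> B}) (g : {rmorphism A -> B}) : Prop :=
  ConductorSquare {
    square_surjA : surjective piA;
    square_kerA : kernel piA = conductor f;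
    square_surjB : surjective piB;
    square_kerB : kernel piB = f @` conductor f;
    square_comm : forall r, g (piA r) = piB (f r) }.

Lemma exists_conductor_square (R S : comNzRingType) (f : {rmorphism R -> S}) :
  injective f -> ~ conductor f 1 ->
  exists (A B : comNzRingType) (piA : {rmorphism R -> A}) (piB : {rmorphism S -> B})
    (g : {rmorphism A -> B}), conductor_square f piA piB g.
Proof.
move=> f_inj nC1.
have [A [piA [surjA kerA]]] := exists_ideal_quotient (conductor_ideal f) nC1.
have [|B [piB [surjB kerB]]] := exists_ideal_quotient (image_conductor_ideal f).
  by move=> [c Cc]; rewrite -(rmorph1 f) => /f_inj c1; apply: nC1; rewrite -c1.
have [r|g gE] := exists_factor_rmorphism (pi := piA) (h := piB \o f) surjA.
  rewrite kerA => Cr; suff : kernel piB (f r) by [].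
  by rewrite kerB; exists r.
by exists A, B, piA, piB, g.
Qed.

Section ConductorSquare.
Variables (R S A B : comNzRingType) (f : {rmorphism R -> S}).
Variables (piA : {rmorphism R -> A}) (piB : {rmorphism S -> B}) (g : {rmorphism A -> B}).
Hypothesis square_f : conductor_square f piA piB g.

Let surjA := square_surjA square_f.
Let kerA r : kernel piA r <-> conductor f r. Proof. by rewrite (square_kerA square_f). Qed.
Let surjB := square_surjB square_f.
Let kerB s : kernel piB s <-> (f @` conductor f) s.
Proof. by rewrite (square_kerB square_f). Qed.
Let gE := square_comm square_f.

Lemma finite_ideals_square :
  finite_set (ideal_above (conductor f)) <-> finite_set (@is_ideal A).
Proof.
split=> fin.
  apply: (finite_set_inj (h := preimage piA)) fin => [U V _ _|I iI].
    exact: preimage_surj_inj.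
  split; first exact: preimage_ideal.
  by move=> r /kerA rA; rewrite /preimage /= rA; exact: ideal0.
apply: (finite_set_inj (h := image^~ piA)) fin => [U V [iU CU] [iV CV] UV|I [iI _]].
  rewrite -(preimage_image_ideal (pi := piA) iU) => [|x /kerA/CU //].
  by rewrite UV (preimage_image_ideal iV) // => x /kerA/CV.
exact: image_ideal.
Qed.

Lemma preimage_subalgebra T : is_subalgebra g T -> is_subalgebra f (piB @^-1` T).
Proof.
move=> sT; split=> [r|x y Tx Ty|x Tx|x y Tx Ty]; rewrite /preimage /=.
- by rewrite -gE; exact: (subalgebra_base sT).
- by rewrite rmorphD; exact: (subalgebraD sT).
- by rewrite rmorphN; exact: (subalgebraN sT).
- by rewrite rmorphM; exact: (subalgebraM sT).
Qed.

Lemma image_subalgebra T : is_subalgebra f T -> is_subalgebra g (piB @` T).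
Proof.
move=> sT; split=> [a|_ _ [x Tx <-] [y Ty <-]|_ [x Tx <-]|_ _ [x Tx <-] [y Ty <-]].
- by have [r <-] := surjA a; rewrite gE; apply: imageP; exact: (subalgebra_base sT).
- by rewrite -rmorphD; apply: imageP; exact: (subalgebraD sT).
- by rewrite -rmorphN; apply: imageP; exact: (subalgebraN sT).
- by rewrite -rmorphM; apply: imageP; exact: (subalgebraM sT).
Qed.

Lemma preimage_image_subalgebra T : is_subalgebra f T -> piB @^-1` (piB @` T) = T.
Proof.
move=> sT; apply: preimage_image_add => [x y|x /kerB[c _ <-]].
  exact: (subalgebraD sT).
exact: (subalgebra_base sT).
Qed.

Lemma finite_subalgebras_square :
  finite_set (is_subalgebra f) <-> finite_set (is_subalgebra g).
Proof.
split=> fin.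
  apply: (finite_set_inj (h := preimage piB)) fin => [U V _ _|T].
    exact: preimage_surj_inj.
  exact: preimage_subalgebra.
apply: (finite_set_inj (h := image^~ piB)) fin => [U V sU sV UV|T].
  by rewrite -(preimage_image_subalgebra sU) UV preimage_image_subalgebra.
exact: image_subalgebra.
Qed.

Lemma preimage_square (Q : set B) : f @^-1` (piB @^-1` Q) = piA @^-1` (g @^-1` Q).
Proof. by apply/predeqP => r; rewrite /preimage /= gE. Qed.

Lemma primes_over_square (N : set A) : is_ideal N ->
  primes_over f (piA @^-1` N) = preimage piB @` primes_over g N.
Proof.
move=> iN; apply/seteqP; split=> [Q [pQ QN]|_ [Q [pQ <-] <-]]; last first.
  by split; [exact: preimage_prime | exact: preimage_square].
have ker_Q : kernel piB `<=` Q.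
  move=> s /kerB[c /kerA cA <-]; suff : (f @^-1` Q) c by [].
  by rewrite QN /preimage /= cA; exact: ideal0.
have QE := preimage_image_ideal (prime_ideal pQ) ker_Q.
exists (piB @` Q) => //; split; first exact: image_prime.
by apply: (preimage_surj_inj surjA); rewrite -preimage_square QE.
Qed.

Lemma two_primes_over_square (N : set A) : is_ideal N ->
  two_primes_over f (piA @^-1` N) <-> two_primes_over g N.
Proof.
move=> iN; rewrite !two_primes_overP primes_over_square //.
exact/is_pair_image/(preimage_surj_inj surjB).
Qed.

Lemma square_conductor a : conductor g a -> a = 0.
Proof.
have [r <-] := surjA a => Cr; apply/kerA => s.
have [b] := Cr (piB s); have [t <-] := surjA b; rewrite !gE -rmorphM => /eqP.
rewrite -subr_eq0 -rmorphB => /eqP/kerB[c _ fc].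
by exists (t - c); rewrite rmorphB fc subKr.
Qed.

Hypotheses (etale_f : etale_ext f) (infra_f : infra_integral_ext f).
Hypothesis gilmer_f : Gilmer_ext f.

Lemma square_nucleus_extension : nucleus_extension g.
Proof.
have [flat fin_pres unr] := etale_f; have [intf isof] := infra_f.
have artA : artinian A := quotient_artinian_surj surjA (square_kerA square_f) gilmer_f.
split=> // [|||Q pQ|]; last exact: square_conductor.
- apply: (module_finite_artinian artA (module_finite_quotient surjB gE _)).
  exact: fin_pres_integral_module_finite.
- apply: (flat_quotient flat surjA surjB _ gE) => s /kerB[c Cc fc].
  by exists c => //; exact/kerA.
- exact: (unramified_quotient unr surjB gE).
apply: (artinian_residue_surj artA pQ) => x y.
have [[s <-] [t <-]] := (surjB x, surjB y) => Qt.
have [a [b [Qb Qab]]] := isof _ (preimage_prime piB pQ) s t Qt.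
by exists (piA a), (piA b); rewrite /Defs.preim !gE -!rmorphM -rmorphB.
Qed.

Lemma residue_surj_square (Q : set B) : is_prime Q -> residue_surj f (piB @^-1` Q).
Proof.
move=> pQ s; have [a] := nucleus_residue_surj square_nucleus_extension pQ (piB s).
by have [r <-] := surjA a; rewrite gE -rmorphB; exists r.
Qed.

Lemma conductor_killed (N : set A) c : is_prime N -> conductor f c ->
  exists2 w, ~ (piA @^-1` N) w & w * c = 0.
Proof.
move=> pN Cc; have [flat _ _] := etale_f.
have [Q1 [Q2 [Q12 [pQ1 Q1N] [pQ2 Q2N]]]] := nucleus_primes_over square_nucleus_extension pN.
rewrite -Q1N -preimage_square.
apply: (flat_conductor flat (Q2 := piB @^-1` Q2)) Cc; do ?exact: preimage_prime.
- by move/(preimage_surj_inj surjB).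
- by rewrite !preimage_square Q1N Q2N.
- exact: residue_surj_square.
- exact: residue_surj_square.
Qed.

Lemma in_supp_square (M : set R) :
  in_supp f M <-> exists2 N, is_prime N & M = piA @^-1` N.
Proof.
split=> [suppM|[N pN ->]].
  have CM := in_supp_conductor suppM; have [pM _] := suppM.
  have kerM : kernel piA `<=` M by rewrite (square_kerA square_f).
  exists (piA @` M); first exact: image_prime.
  by rewrite (preimage_image_ideal (prime_ideal pM) kerM).
have [Q1 [Q2 [Q12 over1 over2]]] := nucleus_primes_over square_nucleus_extension pN.
apply: (primes_over_in_supp (Q1 := piB @^-1` Q1) (Q2 := piB @^-1` Q2)).
- exact: preimage_prime.
- by move/(preimage_surj_inj surjB).
- by rewrite (primes_over_square (prime_ideal pN)); exact: imageP.
- by rewrite (primes_over_square (prime_ideal pN)); exact: imageP.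
Qed.

Lemma two_primes_over_nucleus :
  (forall M, in_supp f M -> loc_SPIR M -> loc_infinite M -> two_primes_over f M) <->
  (forall N, is_prime N -> loc_SPIR N -> loc_infinite N -> two_primes_over g N).
Proof.
have killed N (pN : is_prime N) c :
    kernel piA c -> exists2 w, ~ (piA @^-1` N) w & w * c = 0.
  by move=> /kerA; exact: conductor_killed.
split=> [two N pN|two M /in_supp_square[N pN ->]].
  move=> /(loc_SPIR_quotient surjA pN (killed N pN)) spir.
  move=> /(loc_infinite_quotient surjA pN (killed N pN)) inf.
  apply/(two_primes_over_square (prime_ideal pN))/two => //.
  by apply/in_supp_square; exists N.
move=> /(loc_SPIR_quotient surjA pN (killed N pN)) spir.
move=> /(loc_infinite_quotient surjA pN (killed N pN)) inf.
exact/(two_primes_over_square (prime_ideal pN))/two.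
Qed.

End ConductorSquare.

Theorem theorem3p7 (R S : comNzRingType) (f : {rmorphism R -> S}) :
  injective f -> etale_ext f -> infra_integral_ext f -> Gilmer_ext f ->
  (FIP_ext f <->
     quotient_FMIR (conductor f) /\
     (forall M : R -> Prop, in_supp f M -> loc_SPIR M -> loc_infinite M ->
        two_primes_over f M)).
Proof.
move=> f_inj etale_f infra_f gilmer_f; rewrite FIP_ext_finiteP quotient_FMIR_finiteP.
have [C1|nC1] := pselect (conductor f 1).
  have [fin_sub fin_id] := conductor_full C1; split=> // _; split=> // M suppM.
  by case: (prime1 suppM.1 (in_supp_conductor suppM C1)).
have [A [B [piA [piB [g square_f]]]]] := exists_conductor_square f_inj nC1.
rewrite (finite_subalgebras_square square_f) (finite_ideals_square square_f).
rewrite (two_primes_over_nucleus square_f etale_f infra_f gilmer_f).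
exact: nucleus_FIP (square_nucleus_extension square_f etale_f infra_f gilmer_f).
Qed.
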